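(* Let $(X_m)_{m\in\mathbb N}$ be a sequence of Markov chains, each $X_m=(X_m(t))_{t\ge0}$ taking values in $S_m$, and for each $m$ let $\eta_m,\nu_m$ be a regeneration time and regeneration measure for $X_m$, with $(t_{m,n})_n$ denoting the stopping sequence corresponding to $\eta_m$. Let $A_m\subset S_m$, let $\tau(A_m)=\inf\{t\ge 0\colon X_m(t)\in A_m\}$, let $p_m=P_{\nu_m}(X_m(t)\in A_m\text{ for some }t<\eta_m)$ and let $N_m=\inf\{n\colon \tau(A_m)<t_{m,n}\}$. For $\delta>0$ let $n_m(\delta)=\inf\{n\colon P_{\nu_m}(N_m\le n)\ge\delta\}$. Let $X_m(0)$ have distribution $\nu_m$ for each $m$ and suppose that (i) $p_m\to0$ as $m\to\infty$, and that if $\delta_m\to0$ slowly enough as $m\to\infty$ then (ii) $\big(t_{m,n_m(\delta_m)}/E_{\nu_m}[t_{m,n_m(\delta_m)}]\big)_m$ is uniformly integrable, and (iii) $E_{\nu_m}[t_{m,n_m(\delta_m)}\mid N_m\le n_m(\delta_m)]=O(E_{\nu_m}[t_{m,n_m(\delta_m)}])$ as $m\to\infty$. Then for every $t>0$, $$P_{\nu_m}(\tau(A_m)/E_{\nu_m}[\tau(A_m)]>t)\to e^{-t}\quad\text{as }m\to\infty.$$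
   Context: A Markov chain on a complete separable metric space $S$ means a pure jump strong Markov process $X=(X(t))_{t\ge0}$ on $S$ with a transition rate kernel $q(x,dy)$, i.e. for $x\in S$, Borel $B\subset S$ and small $h>0$, $P(X(t+h)\in B\mid X(t)=x)=h\,q(x,B)+O(h^2)$. $P_\psi,E_\psi$ denote probability and expectation when $X(0)$ has distribution $\psi$. Each $S_m$ is a complete separable metric space. Stopping sequence: if $\eta$ is a stopping time for $X$, viewed as a function of the trajectory $X(\cdot)$, let $\eta(t)$ denote its value for the shifted trajectory $X(t+\cdot)$. The stopping sequence $(t_n)$ corresponding to $\eta$ is $t_0=0$, $t_n=t_{n-1}+\eta(t_{n-1})$. Regeneration time and measure: a stopping time $\eta$ and a probability measure $\nu$ on $S$ such that, for any distribution of $X(0)$, $\eta>0$ almost surely, $X(\eta)$ has distribution $\nu$, and $X(\eta)$ is independent of $X(0)$. A property holds ''if $\delta_m\to0$ slowly enough'' means: there is a positive sequence $\delta_m^*\to0$ such that the property holds for every sequence $\delta_m\to0$ with $\delta_m\ge\delta_m^*$ for all $m$. *)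

(* Defs.v *)
From HB Require Import structures.
From mathcomp Require Import all_boot all_order all_algebra.
From mathcomp Require Import all_classical all_reals all_analysis.

Set Implicit Arguments.
Unset Strict Implicit.
Unset Printing Implicit Defensive.

Import Order.TTheory GRing.Theory Num.Theory.
Import numFieldTopology.Exports numFieldNormedType.Exports.

Local Open Scope classical_set_scope.
Local Open Scope ring_scope.

HB.mixin Record isSeparable T & Topological T := {
  separable_subproof : exists2 D : set T, countable D & dense D }.

(* Nonempty complete separable metric spaces: measurable types have to be
   pointed, and a space carrying a probability measure is nonempty anyway. *)
#[short(type="polishMetricType")]
HB.structure Definition PolishMetric (R : numDomainType) :=
  { T of Metric R T & Complete T & Pointed T & isSeparable T }.

Notation borel S := (g_sigma_algebraType (@open S)).

Section trajectories.
Context {R : realType} (S : polishMetricType R).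

(* Trajectories of pure jump processes: right-continuous for the discrete
   topology, and constant on some interval before every time, i.e. constant
   apart from isolated jumps. A trajectory is a function on [0, +oo[; it is
   extended to the negative reals by its value at 0. *)
Definition step_function (f : R -> S) : Prop :=
  [/\ forall s, s <= 0 -> f s = f 0,
      forall t, \forall s \near t^'+, f s = f t
    & forall t, exists x, \forall s \near t^'-, f s = x].

Record trajectory := Trajectory {
  trajectory_fun :> R -> S ;
  trajectory_step : step_function trajectory_fun }.

Lemma cst_step x : step_function (cst x).
Proof. by split => // t; [near=> s | exists x; near=> s]. Unshelve. all: by end_near. Qed.

HB.instance Definition _ := gen_eqMixin trajectory.
HB.instance Definition _ := gen_choiceMixin trajectory.
HB.instance Definition _ := isPointed.Build trajectory
  (Trajectory (cst_step point)).

Definition coordinate_events (D : set R) : set (set trajectory) :=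
  [set C | exists s B, [/\ D s, (measurable : set (set (borel S))) B
                         & C = [set w : trajectory | B (w s)]]].

Definition trajectory_events : set (set trajectory) :=
  coordinate_events [set s | 0 <= s].

HB.instance Definition _ := @isMeasurable.Build (sigma_display trajectory_events)
  trajectory <<s trajectory_events >> (@sigma_algebra0 _ setT trajectory_events)
  (@sigma_algebraC trajectory trajectory_events)
  (@sigma_algebra_bigcup _ setT trajectory_events).

Lemma shift_step (w : trajectory) (t : R) :
  step_function (fun s => w (t + Num.max s 0)).
Proof.
have [w0 wr wl] := trajectory_step w.
split.
- by move=> s s0; rewrite max_r ?maxxx.
- move=> s; have [s0|s0] := ltP s 0.
    near=> u; have u0 : u <= 0 by near: u; apply: nbhs_right_le.
    by rewrite (max_r u0).
  have /nbhs_right0P h := wr (t + s).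
  apply/nbhs_right0P; near=> e.
  have e0 : 0 < e by near: e; exact: nbhs_right_gt.
  rewrite max_l ?addr_ge0// ?(ltW e0)// addrA.
  by near: e.
- move=> s; have [s0|s0] := leP s 0.
    exists (w t); near=> u.
    have u0 : u < s by near: u; exact: nbhs_left_lt.
    by rewrite max_r ?addr0// ltW// (lt_le_trans u0).
  have [x /nbhs_left0P h] := wl (t + s).
  exists x; apply/nbhs_left0P; near=> e.
  have es : e <= s by near: e; exact: nbhs_right_le.
  rewrite max_l ?subr_ge0// addrA.
  by near: e.
Unshelve. all: by end_near. Qed.

Definition shift (t : R) (w : trajectory) : trajectory :=
  Trajectory (shift_step w t).

(* The natural filtration. *)
Definition past (t : R) : set (set trajectory) :=
  <<s coordinate_events [set s | 0 <= s <= t] >>.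

Definition stopping_time (sigma : trajectory -> \bar R) : Prop :=
  (forall w, (0 <= sigma w)%E) /\
  (forall t, 0 <= t -> past t [set w | (sigma w <= t%:E)%E]).

Definition stopped_past (sigma : trajectory -> \bar R) : set (set trajectory) :=
  [set A | measurable A /\
    forall t, 0 <= t -> past t (A `&` [set w | (sigma w <= t%:E)%E])].

(* The infinite value is kept once reached, the shift being then meaningless. *)
Fixpoint stopping_sequence (eta : trajectory -> \bar R) (n : nat)
    (w : trajectory) : \bar R :=
  if n is k.+1 then
    match stopping_sequence eta k w with
    | r%:E => r%:E + eta (shift r w)
    | t => t
    end%E
  else 0%E.

(* t_n for n in {0, 1, 2, ..., +oo}: as t_0 <= t_1 <= ..., this is t_n when n is
   a natural number, and lim_k t_k when n = +oo. *)
Definition stopping_sequence_at (eta : trajectory -> \bar R) (n : \bar R)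
    (w : trajectory) : \bar R :=
  ereal_sup [set stopping_sequence eta k w | k in [set k : nat | (k%:R%:E <= n)%E]].

Definition hitting_time (A : set S) (w : trajectory) : \bar R :=
  ereal_inf [set t%:E | t in [set t : R | 0 <= t /\ A (w t)]].

Definition hitting_index (A : set S) (eta : trajectory -> \bar R)
    (w : trajectory) : \bar R :=
  ereal_inf [set n%:R%:E | n in
    [set n : nat | (hitting_time A w < stopping_sequence eta n w)%E]].

End trajectories.

Section initial_law.
Context {R : realType} {S : polishMetricType R}.
Variables (P : R.-pker (borel S) ~> trajectory S) (psi : probability (borel S) R).
Local Open Scope ereal_scope.

Definition initial_law (B : set (trajectory S)) : \bar R := \int[psi]_x P x B.

Let initial_law0 : initial_law set0 = 0.
Proof. by apply: integral0_eq => x _; rewrite measure0. Qed.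

Let initial_law_ge0 B : 0 <= initial_law B.
Proof. by apply: integral_ge0 => x _; exact: measure_ge0. Qed.

Let initial_law_sigma_additive : semi_sigma_additive initial_law.
Proof.
move=> F mF tF mUF.
rewrite /initial_law (_ : (fun x => P x _) = (fun x => \sum_(0 <= n <oo) P x (F n))).
  rewrite integral_nneseries//.
    by apply: is_cvg_ereal_nneg_natsum => n _; exact: integral_ge0.
  by move=> n; exact: measurable_kernel.
by apply/funext => x; exact: measure_semi_bigcup.
Qed.

HB.instance Definition _ := isMeasure.Build _ _ _ initial_law
  initial_law0 initial_law_ge0 initial_law_sigma_additive.

Let initial_law_setT : initial_law setT = 1.
Proof.
rewrite /initial_law (eq_integral (cst 1)); last first.
  by move=> x _; rewrite prob_kernel.
by rewrite integral_cst// mul1e; exact: probability_setT.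
Qed.

HB.instance Definition _ :=
  Measure_isProbability.Build _ _ _ initial_law initial_law_setT.

End initial_law.

(* The chain is given by the laws of its trajectories started from the points
   of S. Time-homogeneity is part of the Markov property, so
   P(X(t+h) \in B | X(t) = x) is P_x(X(h) \in B); the jump rate q(x, B) only
   makes sense for x outside B, as P_x(X(h) \in B) --> 1 when x is in B. *)
Record markov_chain (R : realType) (S : polishMetricType R) := MarkovChain {
  chain_law : R.-pker (borel S) ~> trajectory S ;
  chain_law_start : forall x (B : set (borel S)), measurable B -> B x ->
    chain_law x [set w : trajectory S | B (w 0)] = 1%E ;
  chain_strong_markov : forall (psi : probability (borel S) R)
      (sigma : trajectory S -> \bar R) (A B : set (trajectory S)),
    stopping_time sigma -> stopped_past sigma A -> measurable B ->
    (initial_law chain_law psi (A `&` [set w | sigma w < +oo]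
                                  `&` [set w | B (shift (fine (sigma w)) w)]) =
     \int[initial_law chain_law psi]_(w in A `&` [set w | sigma w < +oo])
       chain_law (w (fine (sigma w))) B)%E ;
  chain_rate : R.-ker (borel S) ~> (borel S) ;
  chain_rateP : forall x (B : set (borel S)), measurable B -> ~ B x ->
    exists C h0 : R, 0 < h0 /\ forall h, 0 < h < h0 ->
      (`|chain_law x [set w : trajectory S | B (w h)] - h%:E * chain_rate x B|
         <= (C * h ^+ 2)%:E)%E }.

Definition chain_prob (R : realType) (S : polishMetricType R)
    (X : markov_chain S) (psi : probability (borel S) R) :
    probability (trajectory S) R :=
  initial_law (chain_law X) psi.

Section regeneration.
Context {R : realType} {S : polishMetricType R}.
Variables (X : markov_chain S) (eta : trajectory S -> \bar R)
  (nu : probability (borel S) R).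
Local Open Scope ereal_scope.

Definition regeneration_event (B : set (borel S)) : set (trajectory S) :=
  [set w | eta w < +oo /\ B (w (fine (eta w)))].

(* Taking B = setT in the second condition shows that eta is a.s. finite. *)
Definition regeneration : Prop := stopping_time eta /\
  forall psi : probability (borel S) R,
  [/\ {ae chain_prob X psi, forall w, 0 < eta w},
      forall B, measurable B -> chain_prob X psi (regeneration_event B) = nu B
    & forall B C : set (borel S), measurable B -> measurable C ->
        chain_prob X psi ([set w : trajectory S | C (w 0%R)] `&` regeneration_event B) =
        chain_prob X psi [set w : trajectory S | C (w 0%R)] *
        chain_prob X psi (regeneration_event B)].

Definition excursion_hit_prob (A : set S) : \bar R :=
  chain_prob X nu [set w | exists t : R, [/\ (0 <= t)%R, t%:E < eta w & A (w t)]].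

(* n(delta), in {0, 1, 2, ..., +oo} *)
Definition hitting_quantile (A : set S) (delta : R) : \bar R :=
  ereal_inf [set n%:R%:E | n in [set n : nat |
    delta%:E <= chain_prob X nu [set w | hitting_index A eta w <= n%:R%:E]]].

End regeneration.

(* The expectation of an [0, +oo]-valued variable. *)
Definition mean d (T : measurableType d) (R : realType) (P : probability T R)
  (Y : T -> \bar R) : \bar R := (\int[P]_w Y w)%E.

Definition mean_given d (T : measurableType d) (R : realType)
    (P : probability T R) (Y : T -> \bar R) (E : set T) : \bar R :=
  ((\int[P]_(w in E) Y w) / P E)%E.

Definition uniformly_integrable (R : realType) (I : Type) (D : set I)
    (d : I -> measure_display) (T : forall i, measurableType (d i))
    (P : forall i, probability (T i) R) (Y : forall i, T i -> \bar R) : Prop :=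
  forall e : R, 0 < e -> exists K : R, forall i, D i ->
    (\int[P i]_(w in [set w | K%:E < `|Y i w|]) `|Y i w| <= e%:E)%E.

Definition if_slowly_enough (R : realType) (Q : (nat -> R) -> Prop) : Prop :=
  exists delta0 : nat -> R,
  [/\ forall m, 0 < delta0 m, delta0 @ \oo --> (0 : R)
    & forall delta : nat -> R, delta @ \oo --> (0 : R) ->
        (forall m, delta0 m <= delta m) -> Q delta].

(* Main.v *)
(* The excursions between regeneration times are only 1-dependent: X(t_(k+1)) has
   law nu and is independent of the past up to t_k, hence so is the whole future
   after t_(k+1), but the end point of an excursion may depend on the excursion.

   Group the excursions into blocks of n = n_m(delta_m), where delta_m decreases
   so slowly that p_m <= delta_m^2. A block contains a hit with probability close
   to delta_m, and dropping one excursion per block, at a cost of at most p_m per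
   block, makes the blocks independent: the probability that the first k blocks
   contain no hit is (1 - delta_m)^k up to k p_m, which tends to e^{-x} when
   k ~ x / delta_m. By uniform integrability the k blocks have total duration
   k mu_m (1 + o(1)) in probability, mu_m being the mean duration of a block
   (truncation, and Chebyshev's inequality for a 1-dependent sum), so that
   tau delta_m / mu_m converges in law to an exponential variable.

   For the normalization, E[tau] <= mu_m sum_j P(no hit in the first j blocks with
   their last excursion removed) <= mu_m / (delta_m - p_m), while the convergence
   in law gives liminf E[tau] delta_m / mu_m >= 1. *)
Require Import Defs.
From HB Require Import structures.
From mathcomp Require Import all_boot all_order all_algebra.
From mathcomp Require Import all_classical all_reals all_analysis.
From mathcomp Require Import measurable_realfun.
From mathcomp Require Import ring lra.
Import Order.TTheory GRing.Theory Num.Theory.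
Import numFieldTopology.Exports numFieldNormedType.Exports.
Local Open Scope classical_set_scope.
Local Open Scope ring_scope.
Local Notation shift := Defs.shift.

Set Implicit Arguments.
Unset Strict Implicit.
Unset Printing Implicit Defensive.

(** The threshold is the maximum of the sequence granted by the hypothesis and sqrt p_m: it is slow
    enough, and the gaps between k ~ x / delta_m blocks then cost about x delta_m in total. The
    block length is a quantile, so its hit probability is only known to be at least delta_m;
    removing the last excursion brings it below delta_m at a cost of at most p_m, which confines the
    no-hit probability of the shortened block to ]1 - delta_m, 1 - delta_m + delta_m^2].

    Regeneration makes X(eta) independent of X(0) only. Independence from the whole past up to t_k
    comes from its validity for all initial laws: applied to Dirac masses it gives X(eta) the law nu
    from every point, so the strong Markov property at t_k integrates a constant.

    Convergence in law is proved on the fixed scale mu_m / delta_m. The lower bound on E[tau] then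
    needs the tail at finitely many points only, through a Riemann sum, and monotonicity of the tail
    allows the change of scale to E[tau]. *)

Lemma measurable_fun_le_fin d (T : measurableType d) (R : realType)
    (f : T -> \bar R) :
  (forall t : R, measurable [set x | (f x <= t%:E)%E]) -> measurable_fun setT f.
Proof.
move=> mf; apply: (measurability _ (ErealGenOInfty.measurableE R)) => //.
move=> _ [_ [r ->] <-]; rewrite setTI.
rewrite (_ : _ @^-1` _ = ~` [set x | (f x <= r%:E)%E]); first exact: measurableC.
by apply/seteqP; split=> x /=; rewrite in_itv/= andbT ltNge => /negP.
Qed.

Arguments Defs.shift : simpl never.
Arguments trajectory_fun : simpl never.

(** * Stopping times and stopped trajectories *)

Section stopping.
Context {R : realType} {S : polishMetricType R}.
Implicit Types (w : trajectory S) (s t u r : R).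

Lemma trajectory_ext w w' : (forall s, 0 <= s -> w s = w' s) -> w = w'.
Proof.
case: w w' => [f Hf] [g Hg] fg0; have {fg0}fg : forall s, 0 <= s -> f s = g s := fg0.
suff e : f = g.
  by move: Hg {fg}; rewrite -e => Hg; congr Trajectory; exact: Prop_irrelevance.
apply/funext => s; have [s0|/ltW s0] := leP 0 s; first exact: fg.
by case: Hf => /(_ _ s0) -> _ _; case: Hg => /(_ _ s0) -> _ _; exact: fg.
Qed.

Lemma stop_step w t : step_function (fun s => w (Num.min s (Num.max t 0))).
Proof.
have [w0 wr wl] := trajectory_step w.
set T := Num.max t 0; have T0 : 0 <= T by rewrite /T le_max lexx orbT.
split.
- move=> s s0; rewrite !min_l//; last exact: le_trans T0.
  exact: w0.
- move=> s; have [sT|Ts] := ltP s T.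
    near=> u; rewrite (min_l (ltW _)); last first.
      by near: u; exact: nbhs_right_lt.
    by near: u; exact: wr.
  near=> u; congr (trajectory_fun w _).
  by rewrite min_r// (le_trans Ts)// ltW//; near: u; exact: nbhs_right_gt.
- move=> s; have [sT|Ts] := leP s T.
    have [x wx] := wl s; exists x; near=> u; rewrite min_l.
      by near: u.
    by rewrite (le_trans _ sT)// ltW//; near: u; exact: nbhs_left_lt.
  exists (w T); near=> u; congr (trajectory_fun w _).
  by rewrite min_r//; near: u; exact: nbhs_left_ge.
Unshelve. all: by end_near. Qed.

(** Freezing at time t is the tool for deciding adaptedness; a negative t is read as 0, so that the
    construction is total. *)
Definition stop t w : trajectory S := Trajectory (stop_step w t).

Arguments stop : simpl never.

Lemma stopE t w s : 0 <= t -> stop t w s = w (Num.min s t).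
Proof. by move=> t0; rewrite /trajectory_fun /= (max_l t0). Qed.

Lemma stop_le t w s : 0 <= s <= t -> stop t w s = w s.
Proof.
by move=> /andP[s0 st]; rewrite stopE ?(le_trans s0)// min_l.
Qed.

Lemma stop_stop t u w : 0 <= u <= t -> stop u (stop t w) = stop u w.
Proof.
move=> /andP[u0 ut]; apply: trajectory_ext => s s0.
rewrite !stopE// ?(le_trans u0)//; congr (trajectory_fun w _).
by rewrite min_l// ge_min ut orbT.
Qed.

Lemma shiftE t w s : 0 <= s -> shift t w s = w (t + s).
Proof. by move=> s0; rewrite /trajectory_fun /= (max_l s0). Qed.

Lemma shift0 w : shift 0 w = w.
Proof. by apply: trajectory_ext => s s0; rewrite shiftE// add0r. Qed.

Lemma shift_shift t u w : 0 <= t -> shift t (shift u w) = shift (u + t) w.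
Proof.
move=> t0; apply: trajectory_ext => s s0.
by rewrite !shiftE// ?addr_ge0// addrA.
Qed.

Lemma shift_stop t r w : 0 <= r <= t ->
  shift r (stop t w) = stop (t - r) (shift r w).
Proof.
move=> /andP[r0 rt]; apply: trajectory_ext => s s0.
rewrite shiftE// stopE ?(le_trans r0)// stopE ?subr_ge0// shiftE; last first.
  by rewrite le_min s0 subr_ge0.
by congr (trajectory_fun w _); rewrite addr_minr subrKC.
Qed.

Lemma measurable_at s (B : set (borel S)) : 0 <= s -> measurable B ->
  measurable [set w : trajectory S | B (w s)].
Proof. by move=> s0 mB; apply: sub_sigma_algebra; exists s, B. Qed.

Lemma measurable_to_trajectory d (T : measurableType d) (f : T -> trajectory S) :
  (forall s (B : set (borel S)), 0 <= s -> measurable B ->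
     measurable [set x | B (f x s)]) ->
  measurable_fun setT f.
Proof.
move=> mf; apply: (measurability (@trajectory_events R S)) => //.
by move=> _ [_ [s [B [/= s0 mB ->]] <-]]; rewrite setTI; exact: mf.
Qed.

Lemma past_sub t A : past t A -> measurable (A : set (trajectory S)).
Proof.
have sub : coordinate_events [set s | 0 <= s <= t] `<=` @trajectory_events R S.
  by move=> _ [s [B [/= /andP[s0 _] mB ->]]]; exists s, B.
exact: (sub_smallest2r (smallest_sigma_algebra _ _) sub).
Qed.

(* Galmarino's test *)
Lemma pastP t (A : set (trajectory S)) : 0 <= t ->
  past t A <-> measurable A /\ (forall w, A (stop t w) <-> A w).
Proof.
move=> t0; split=> [pA|[mA iA]].
  split; first exact: past_sub pA.
  pose G : set (set (trajectory S)) := [set A | forall w, A (stop t w) <-> A w].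
  suff : past t `<=` G by exact.
  apply: smallest_sub; last first.
    by move=> _ [s [B [/= sst _ ->]]] w; rewrite /= stop_le.
  split=> [//|C GC w|F GF w].
    by split=> -[_ nC]; split=> // /GC.
  by split=> -[i _ Fi]; exists i => //; exact/GF.
(* An invariant A is its own preimage under [stop t], and such preimages lie in the past of t: the
   coordinate at s becomes the coordinate at min(s, t). *)
rewrite (_ : A = stop t @^-1` A); last first.
  by apply/seteqP; split=> w /= /iA.
pose G : set (set (trajectory S)) := [set A | past t (stop t @^-1` A)].
suff : measurable `<=` G by exact.
apply: smallest_sub.
  have sp : sigma_algebra setT (past t : set (set (trajectory S))).
    exact: smallest_sigma_algebra.
  split=> [|C GC|F GF]; rewrite /G /=.
  - by rewrite preimage_set0; case: sp.
  - by rewrite setTD preimage_setC -setTD; case: sp => _ + _; apply.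
  - by rewrite preimage_bigcup; case: sp => _ _; apply.
move=> _ [s [B [/= s0 mB ->]]]; rewrite /G /=.
apply: sub_sigma_algebra; exists (Num.min s t), B; split=> //=.
  by rewrite le_min s0 t0 ge_min lexx orbT.
by apply/seteqP; split=> w /=; rewrite stopE.
Qed.

(** Galmarino's test for the events sigma <= t: adaptedness becomes measurability plus insensitivity
    to freezing, which is checked trajectory by trajectory. *)
Lemma stopping_timeP (sigma : trajectory S -> \bar R) :
  stopping_time sigma <-> [/\ forall w, (0 <= sigma w)%E,
    measurable_fun setT sigma &
    forall t w, 0 <= t -> (sigma (stop t w) <= t%:E)%E = (sigma w <= t%:E)%E].
Proof.
split=> [[s0 sp]|[s0 ms si]]; last first.
  split=> // t t0; apply/pastP => //; split.
    rewrite -[X in measurable X]setTI; exact: emeasurable_fun_infty_c.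
  by move=> w /=; rewrite si.
split=> //; last first.
  by move=> t w t0; have /pastP-/(_ t0)[_ /(_ w) /= [? ?]] := sp _ t0; apply/idP/idP.
apply: measurable_fun_le_fin => t; have [t0|t0] := leP 0 t.
  exact: past_sub (sp _ t0).
rewrite (_ : [set _ | _] = set0)//; apply/seteqP; split=> w //=.
by move=> /(le_trans (s0 w)); rewrite lee_fin leNgt t0.
Qed.

Lemma stopping_time_stop (sigma : trajectory S -> \bar R) t w :
  stopping_time sigma -> (sigma w <= t%:E)%E -> sigma (stop t w) = sigma w.
Proof.
move=> /stopping_timeP[s0 _ si] st.
have t0 : 0 <= t by rewrite -lee_fin (le_trans (s0 w)).
have iff u : 0 <= u <= t -> (sigma (stop t w) <= u%:E)%E = (sigma w <= u%:E)%E.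
  by move=> /[dup] /andP[u0 _] ut; rewrite -si// stop_stop// si.
have := st; rewrite -si//; move: (iff) (s0 w) (s0 (stop t w)) st.
case: (sigma w) => [a| |]//; case: (sigma (stop t w)) => [b| |]//.
move=> {}iff; rewrite !lee_fin => a0 b0 at_ bt; congr (_%:E); apply/eqP.
rewrite eq_le; apply/andP; split.
  by rewrite -lee_fin iff ?lexx ?a0.
by rewrite -lee_fin -iff ?lexx ?b0.
Qed.

Lemma stopped_pastP (sigma : trajectory S -> \bar R) (A : set (trajectory S)) :
  stopping_time sigma ->
  stopped_past sigma A <-> measurable A /\
    (forall t w, (sigma w <= t%:E)%E -> A (stop t w) <-> A w).
Proof.
move=> st; have /stopping_timeP[s0 ms si] := st.
split=> [[mA pA]|[mA iA]]; split=> // t.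
  move=> w sw; have t0 : 0 <= t by rewrite -lee_fin (le_trans (s0 w)).
  have /pastP-/(_ t0)[_ /(_ w) /= [h1 h2]] := pA _ t0; rewrite si// in h1 h2.
  by split=> ?; [case: h1|case: h2].
move=> t0; apply/pastP => //; split.
  apply: measurableI => //.
  by rewrite -[X in measurable X]setTI; exact: emeasurable_fun_infty_c.
move=> w; rewrite /= si//; split=> -[Aw sw]; split=> //; exact/(iA t).
Qed.

(** The random time is discretized from above with mesh 1 / (k + 1). Trajectories are locally
    constant to the right, so the value at the grid time is eventually the value at the random time,
    and the event is a lower limit of measurable events. *)
Lemma measurable_random_time d (T : measurableType d) (r : T -> R)
    (f : T -> trajectory S) (B : set (borel S)) :
  (forall x, 0 <= r x) -> measurable_fun setT r -> measurable_fun setT f ->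
  measurable B -> measurable [set x | B (f x (r x))].
Proof.
move=> r0 mr mf mB.
pose J k x := (Num.truncn (r x * k.+1%:R)).+1%:R / k.+1%:R : R.
have mJ k : measurable [set x | B (f x (J k x))].
  rewrite (_ : [set _ | _] = \bigcup_j ((r @^-1` `[j%:R / k.+1%:R, j.+1%:R / k.+1%:R[)
      `&` f @^-1` [set w : trajectory S | B (w (j.+1%:R / k.+1%:R))])).
    apply: bigcupT_measurable => j; apply: measurableI.
      by rewrite -[X in measurable X]setTI; exact: mr.
    rewrite -[X in measurable X]setTI; apply: mf => //.
    by apply: measurable_at => //; exact: divr_ge0.
  have h x j : (j%:R / k.+1%:R <= r x < j.+1%:R / k.+1%:R) =
               (Num.truncn (r x * k.+1%:R) == j).
    rewrite ler_pdivrMr// ltr_pdivlMr//.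
    by apply/idP/eqP => [/truncn_def//|<-]; rewrite truncn_itv// mulr_ge0.
  apply/seteqP; split=> x /=.
    move=> Bx; exists (Num.truncn (r x * k.+1%:R)) => //; split=> //=.
    by rewrite in_itv/= h.
  by move=> [j _ [/=]]; rewrite in_itv/= h /J => /eqP ->.
rewrite (_ : [set _ | _] = \bigcup_k0 \bigcap_(k in [set k | (k0 <= k)%N])
    [set x | B (f x (J k x))]).
  by apply: bigcupT_measurable => k0; apply: bigcap_measurableType.
have ev x : \forall k \near \oo, f x (J k x) = f x (r x).
  have [_ /(_ (r x)) wr _] := trajectory_step (f x).
  have /nbhs_right0P [e /= e0 he] := wr.
  near=> k.
  have k0 : 0 < k.+1%:R :> R by [].
  have Jr : r x < J k x.
    rewrite /J ltr_pdivlMr//; have := truncn_itv (x := r x * k.+1%:R).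
    by rewrite mulr_ge0// => /(_ isT) /andP[].
  have Jr2 : J k x <= r x + k.+1%:R^-1.
    rewrite /J ler_pdivrMr// mulrDl mulVf// -natr1 lerD2r.
    have := truncn_itv (x := r x * k.+1%:R).
    by rewrite mulr_ge0// => /(_ isT) /andP[].
  rewrite -[J k x](subrKC (r x)); apply: he => /=; last by rewrite subr_gt0.
  rewrite sub0r normrN gtr0_norm ?subr_gt0//.
  rewrite ltrBlDl (le_lt_trans Jr2)// ltrD2l.
  near: k; exact: near_infty_natSinv_lt (PosNum e0).
apply/seteqP; split=> x /=.
  move=> Bx; have [k0 _ hk0] := ev x; exists k0 => // k /= k0k.
  by rewrite hk0.
move=> [k0 _ hk0]; have [k1 _ hk1] := ev x.
have := hk1 (maxn k0 k1) (leq_maxr _ _).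
by have /= h := hk0 (maxn k0 k1) (leq_maxl _ _) => /= <-.
Unshelve. all: by end_near. Qed.

Lemma measurable_random_shift d (T : measurableType d) (r : T -> R)
    (f : T -> trajectory S) :
  (forall x, 0 <= r x) -> measurable_fun setT r -> measurable_fun setT f ->
  measurable_fun setT (fun x => shift (r x) (f x)).
Proof.
move=> r0 mr mf; apply: measurable_to_trajectory => s B s0 mB.
rewrite (_ : [set _ | _] = [set x | B (f x (r x + s))]).
  apply: measurable_random_time => //; first by move=> x; rewrite addr_ge0.
  exact: measurable_funD.
by apply/seteqP; split=> x /=; rewrite shiftE.
Qed.

(** * The stopping sequence consists of stopping times *)

Variable eta : trajectory S -> \bar R.
Hypothesis eta_stop : stopping_time eta.
Local Notation T := (stopping_sequence eta).

Lemma stopping_sequence_ge0 n w : (0 <= T n w)%E.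
Proof.
have [e0 _] := eta_stop.
elim: n => [|n] //=; case: (T n w) => [r| |]// r0; exact: adde_ge0.
Qed.

(** The sequence restarts at t_a. Finiteness of t_a is essential, since [fine] would turn an
    infinite t_a into 0. *)
Lemma stopping_sequenceD a b w : (T a w < +oo)%E ->
  T (a + b) w = (T a w + T b (shift (fine (T a w)) w))%E.
Proof.
move=> Ta; have Ta0 := stopping_sequence_ge0 a w.
have Taf : T a w \is a fin_num by rewrite ge0_fin_numE.
elim: b => [|b IH]; first by rewrite addn0 /= adde0.
rewrite addnS /= {}IH.
have := stopping_sequence_ge0 b (shift (fine (T a w)) w).
case E : (T b _) => [r| |]// r0.
  move: Taf Ta0 E; case: (T a w) => //= s _ s0 E.
  by rewrite shift_shift// EFinD addeA.
by rewrite addey ?gt_eqF// (lt_le_trans _ Ta0).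
Qed.

Lemma stopping_sequence_y a b w : T a w = +oo%E -> T (a + b) w = +oo%E.
Proof. by move=> Ta; elim: b => [|b]; rewrite ?addn0// addnS /= => ->. Qed.

Lemma stopping_sequence_le a b w : (a <= b)%N -> (T a w <= T b w)%E.
Proof.
move=> ab; rewrite -(subnKC ab); have := stopping_sequence_ge0 a w.
case E : (T a w) => [r| |]// r0; last by rewrite stopping_sequence_y.
rewrite stopping_sequenceD E ?ltry// leeDl//; exact: stopping_sequence_ge0.
Qed.

Lemma measurable_stopping_sequence n : measurable_fun setT (T n).
Proof.
have /stopping_timeP[e0 me _] := eta_stop.
elim: n => [|n IH]; first exact: measurable_cst.
have h w : T n.+1 w = (T n w + eta (shift (fine (T n w)) w))%E.
  have := stopping_sequence_ge0 n w; have := e0 (shift (fine (T n w)) w) => /=.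
  case: (T n w) => [r| |]//= ? _.
  by rewrite addye// gt_eqF// (lt_le_trans _ (e0 _)).
rewrite (funext h); apply: emeasurable_funD => //.
apply: measurableT_comp => //; apply: measurable_random_shift => //.
- by move=> x; apply: fine_ge0; exact: stopping_sequence_ge0.
- by apply: measurableT_comp.
Qed.

Lemma stopping_sequence_stop n t w :
  (T n w <= t%:E)%E -> T n (stop t w) = T n w.
Proof.
elim: n => //= n IH; have := stopping_sequence_ge0 n w.
case E : (T n w) => [r| |]// r0 h.
have [e0 _] := eta_stop.
have rt : (r%:E <= t%:E)%E by rewrite (le_trans _ h)// leeDl.
rewrite IH ?E// shift_stop; last by rewrite -!lee_fin rt r0.
rewrite stopping_time_stop//.
by rewrite EFinB leeBrDl.
Qed.

Lemma stopping_sequence_stopping_time n : stopping_time (T n).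
Proof.
apply/stopping_timeP; split.
- exact: stopping_sequence_ge0.
- exact: measurable_stopping_sequence.
move=> t w t0; apply/idP/idP => h; last by rewrite stopping_sequence_stop.
elim: n h => //= n IH; have := stopping_sequence_ge0 n (stop t w).
case E : (T n (stop t w)) => [r| |]// r0 h.
have [e0 _] := eta_stop.
have rt : (r%:E <= t%:E)%E by rewrite (le_trans _ h)// leeDl.
have Ew : T n w = r%:E by rewrite -E (@stopping_sequence_stop n t w) ?IH ?E.
rewrite Ew; move: h.
rewrite shift_stop; last by rewrite -!lee_fin rt r0.
rewrite -!leeBrDl// -!EFinB.
by have /stopping_timeP[_ _ ->] := eta_stop; rewrite // subr_ge0 -lee_fin.
Qed.

Lemma stopped_past_le a b : (a <= b)%N -> stopped_past (T a) `<=` stopped_past (T b).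
Proof.
move=> ab A /stopped_pastP-/(_ (stopping_sequence_stopping_time a))[mA iA].
apply/stopped_pastP; first exact: stopping_sequence_stopping_time.
split=> // t w h; apply: iA; apply: le_trans h; exact: stopping_sequence_le.
Qed.

End stopping.

(** * Hitting times *)

Section hitting.
Context {R : realType} {S : polishMetricType R}.
Implicit Types (w : trajectory S) (s t u r : R) (A : set (borel S)).

Lemma hitting_time_ltP A w (c : \bar R) :
  (hitting_time A w < c)%E <-> exists t, [/\ 0 <= t, (t%:E < c)%E & A (w t)].
Proof.
split=> [/ereal_inf_lt[_ [t [t0 At] <-] tc]|[t [t0 tc At]]]; first by exists t.
by apply: le_lt_trans tc; apply: ereal_inf_lbound; exists t.
Qed.

Lemma hitting_time_ge0 A w : (0 <= hitting_time A w)%E.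
Proof. by apply: le_ereal_inf_tmp => _ [t [t0 _] <-]; rewrite lee_fin. Qed.

Lemma trajectory_right w t : exists2 e, 0 < e & forall u, t <= u < t + e -> w u = w t.
Proof.
have [_ /(_ t) /nbhs_right0P [e /= e0 he] _] := trajectory_step w.
exists e => // u /andP[tu ute]; have [->//|ut] := eqVneq u t.
rewrite -[u](subrKC t); apply: he => /=; last by rewrite subr_gt0 lt_neqAle eq_sym ut.
by rewrite sub0r normrN ger0_norm ?subr_ge0// ltrBlDl.
Qed.

(** A trajectory keeps each value for some time, so a visit before r can be moved to a rational time
    before r. This works for every Borel A. *)
Lemma measurable_hitting_time A : measurable A ->
  measurable_fun setT (hitting_time A : trajectory S -> \bar R).
Proof.
move=> mA.
have mlt r : measurable [set w : trajectory S | (hitting_time A w < r%:E)%E].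
  have -> : [set w : trajectory S | (hitting_time A w < r%:E)%E] = \bigcup_(q : rat)
     [set w : trajectory S | (0 <= (ratr q : R) < r)%R /\ A (w (ratr q))]; last first.
    apply: bigcupT_measurable_rat => q; have [/andP[q0 _]|_] := boolP (0 <= (ratr q : R) < r).
      rewrite [X in measurable X](_ : _ = [set w : trajectory S | A (w (ratr q))]).
        exact: measurable_at.
      by apply/seteqP; split=> w /=; [case|split].
    rewrite [X in measurable X](_ : _ = set0)//.
    by apply/seteqP; split=> w /=; [case|case].
  apply/seteqP; split=> w /=.
    move=> /hitting_time_ltP[t [t0]]; rewrite lte_fin => tr At.
    have [e e0 he] := trajectory_right w t.
    have : t < Num.min r (t + e) by rewrite lt_min tr ltrDl e0.
    move=> /rat_in_itvoo [q]; rewrite in_itv/= lt_min => /and3P[tq qr qe].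
    exists q => //; split; first by rewrite (le_trans t0 (ltW tq)) qr.
    by rewrite he// (ltW tq).
  move=> [q _ [/andP[q0 qr] Aq]]; apply/hitting_time_ltP.
  by exists (ratr q).
apply: measurable_fun_le_fin => t.
have -> : [set w : trajectory S | (hitting_time A w <= t%:E)%E] =
    \bigcap_k [set w | (hitting_time A w < (t + k.+1%:R^-1)%:E)%E]; last first.
  by apply: bigcap_measurableType.
apply/seteqP; split=> w /= h.
  by move=> k _ /=; apply: le_lt_trans h _; rewrite lte_fin ltrDl.
apply/lee_addgt0Pr => e e0.
have [k ke] : exists k, k.+1%:R^-1 < e.
  have [k _ hk] := near_infty_natSinv_lt (PosNum e0); exists k; exact: (hk k (leqnn k)).
by apply: ltW; apply: (lt_le_trans (h k I)); rewrite -EFinD lee_fin lerD2l ltW.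
Qed.

Variables (eta : trajectory S -> \bar R) (A : set (borel S)).
Hypotheses (eta_stop : stopping_time eta) (mA : measurable A).
Local Notation T := (stopping_sequence eta).

(** A visit at t_n itself belongs to the next excursion, in accordance with the strict inequality in
    [hitting_index]. *)
Definition no_hit n : set (trajectory S) := [set w | (T n w <= hitting_time A w)%E].

Lemma hitting_index_leE n : [set w | (hitting_index A eta w <= n%:R%:E)%E] = ~` no_hit n.
Proof.
apply/seteqP; split=> w /=; rewrite /no_hit /=.
  move=> h; apply/negP; rewrite -ltNge.
  have : (hitting_index A eta w < n.+1%:R%:E)%E.
    by apply: le_lt_trans h _; rewrite lte_fin ltr_nat.
  move=> /ereal_inf_lt[_ [k /= hk <-]]; rewrite lte_fin ltr_nat ltnS => kn.
  by apply: lt_le_trans hk _; exact: stopping_sequence_le.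
move=> /negP; rewrite -ltNge => h; apply: ereal_inf_lbound; by exists n.
Qed.

Lemma no_hitS_le a b : (a <= b)%N -> no_hit b `<=` no_hit a.
Proof. by move=> ab w; apply: le_trans; exact: stopping_sequence_le. Qed.

Lemma no_hit0 : no_hit 0 = setT.
Proof. by apply/seteqP; split=> w // _; exact: hitting_time_ge0. Qed.

(** A visit before t_(a+b) occurs either before t_a or at t_a + t, where t is a visit time of the
    shifted trajectory. *)
Lemma no_hitD a b w : (T a w < +oo)%E ->
  no_hit (a + b) w <-> no_hit a w /\ no_hit b (shift (fine (T a w)) w).
Proof.
move=> Ta; have Ta0 := stopping_sequence_ge0 eta_stop a w.
have Taf : T a w \is a fin_num by rewrite ge0_fin_numE.
rewrite /no_hit /= stopping_sequenceD//; set r := fine (T a w).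
have r0 : 0 <= r by exact: fine_ge0.
have Er : T a w = r%:E by rewrite fineK.
set w' := shift r w.
have b0 : (0 <= T b w')%E by exact: stopping_sequence_ge0.
rewrite Er; split=> [h|[h1 h2]].
  split; first by apply: le_trans h; rewrite leeDl.
  rewrite leNgt; apply/negP => /hitting_time_ltP[t [t0 tb]].
  rewrite /w' shiftE// => At; move: h; rewrite leNgt => /negP; apply.
  apply/hitting_time_ltP; exists (r + t); split => //; first exact: addr_ge0.
  by rewrite EFinD lteD2lE.
rewrite leNgt; apply/negP => /hitting_time_ltP[t [t0 tb At]].
have [tr|rt] := ltP t r.
  move: h1; rewrite leNgt => /negP; apply; apply/hitting_time_ltP.
  by exists t; split => //; rewrite lte_fin.
move: h2; rewrite leNgt => /negP; apply; apply/hitting_time_ltP.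
exists (t - r); split; first by rewrite subr_ge0.
  by rewrite EFinB lteBlDl.
by rewrite /w' shiftE ?subr_ge0// subrKC.
Qed.

Lemma measurable_no_hit n : measurable (no_hit n).
Proof.
rewrite /no_hit -[X in measurable X]setTI; apply: measurable_lee => //.
  exact: measurable_stopping_sequence.
exact: measurable_hitting_time.
Qed.

(** The event is decided by the trajectory up to t_n, which freezing at any t >= t_n leaves
    intact. *)
Lemma no_hit_stopped_past n : stopped_past (T n) (no_hit n).
Proof.
apply/stopped_pastP; first exact: stopping_sequence_stopping_time.
split; first exact: measurable_no_hit.
move=> t w h; rewrite /no_hit /= stopping_sequence_stop//.
have aux w1 w2 : (forall u, 0 <= u <= t -> w1 u = w2 u) ->
    (T n w <= hitting_time A w1)%E -> (T n w <= hitting_time A w2)%E.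
  move=> e h1; rewrite leNgt; apply/negP => /hitting_time_ltP[u [u0 ut Au]].
  move: h1; rewrite leNgt => /negP; apply; apply/hitting_time_ltP.
  exists u; split => //; rewrite e// u0 -lee_fin; exact: le_trans (ltW ut) h.
by split; apply: aux => u ut; rewrite stop_le.
Qed.

Lemma stopping_sequence_at_nat n w : stopping_sequence_at eta n%:R%:E w = T n w.
Proof.
apply/eqP; rewrite eq_le; apply/andP; split.
  apply: ge_ereal_sup => _ [k /= kn <-]; apply: stopping_sequence_le => //.
  by rewrite lee_fin ler_nat in kn.
by apply: ereal_sup_ubound; exists n => /=.
Qed.

Lemma stopping_sequence_at_y n w : (T n w <= stopping_sequence_at eta +oo w)%E.
Proof. by apply: ereal_sup_ubound; exists n => //=; rewrite leey. Qed.

End hitting.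

(** * Independence along the stopping sequence *)

Section measure_facts.
Context d d' (T : measurableType d) (U : measurableType d') (R : realType).
Local Open Scope ereal_scope.

Lemma measure_setI_full (P : {measure set T -> \bar R}) (A E : set T) :
  measurable A -> measurable E -> P (~` E) = 0 -> P (A `&` E) = P A.
Proof.
move=> mA mE PE; rewrite [RHS](measureDI P mA mE) [X in X + _](_ : _ = 0) ?add0e//.
apply/eqP; rewrite eq_le measure_ge0 andbT -PE; apply: le_measure; rewrite ?inE.
- exact: measurableD.
- exact: measurableC.
- by move=> x [].
Qed.

Lemma ge0_integral_full (P : {measure set T -> \bar R}) (E : set T) (f : T -> \bar R) :
  measurable E -> P (~` E) = 0 -> measurable_fun setT f -> (forall x, 0 <= f x) ->
  \int[P]_x f x = \int[P]_(x in E) f x.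
Proof.
move=> mE PE mf f0.
rewrite (@ge0_negligible_integral _ _ _ _ setT (~` E))//; last exact: measurableC.
by rewrite setTD setCK.
Qed.

Lemma integral_mrestr (P : {measure set T -> \bar R}) (A : set T) (mA : measurable A)
    (f : T -> \bar R) : measurable_fun setT f -> (forall x, 0 <= f x) ->
  \int[mrestr P mA]_x f x = \int[P]_(x in A) f x.
Proof.
move=> mf f0; have h : mrestr P mA (~` A) = 0 by rewrite /mrestr setICl measure0.
rewrite (ge0_integral_full mA h)//.
by apply: eq_measure_integral => B mB BA; rewrite -[in RHS](setIidl BA).
Qed.

(** The image under Z of P restricted to A is c rho, and the claim is a change of variables. In the
    applications c is P A and rho is the law of Z. *)
Lemma ge0_integral_indep_set (P : {measure set T -> \bar R}) (rho : {measure set U -> \bar R})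
    (A : set T) (c : {nonneg R}) (Z : T -> U) (g : U -> \bar R) :
  measurable A -> measurable_fun setT Z -> measurable_fun setT g ->
  (forall x, 0 <= g x) ->
  (forall B, measurable B -> P (A `&` Z @^-1` B) = c%:num%:E * rho B) ->
  \int[P]_(x in A) g (Z x) = c%:num%:E * \int[rho]_x g x.
Proof.
move=> mA mZ mg g0 h.
have mgZ : measurable_fun setT (g \o Z) by exact: measurableT_comp.
rewrite -ge0_integral_mscale// -(integral_mrestr P mA mgZ); last by move=> x; exact: g0.
rewrite -[X in integral _ X](preimage_setT Z) -(ge0_integral_pushforward mZ)//.
pose Z' : {mfun T >-> U} := HB.pack Z (isMeasurableFun.Build _ _ _ _ _ mZ).
apply: (@eq_measure_integral _ _ _ setT (mscale c rho) (pushforward (mrestr P mA) Z')).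
by move=> B mB _; rewrite -[RHS](h B mB) setIC.
Qed.

Lemma ge0_integral_mul_indep (P : probability T R) (F G : T -> R) :
  measurable_fun setT F -> measurable_fun setT G ->
  (forall x, (0 <= F x)%R) -> (forall x, (0 <= G x)%R) ->
  (forall A B, measurable A -> measurable B ->
     P (F @^-1` A `&` G @^-1` B) = P (F @^-1` A) * P (G @^-1` B)) ->
  \int[P]_x (F x * G x)%:E = \int[P]_x (F x)%:E * \int[P]_x (G x)%:E.
Proof.
move=> mF mG F0 G0 h.
pose F' : {mfun T >-> R} := HB.pack F (isMeasurableFun.Build _ _ _ _ _ mF).
pose G' : {mfun T >-> R} := HB.pack G (isMeasurableFun.Build _ _ _ _ _ mG).
pose H x := (F x, G x).
have mH : measurable_fun setT H by exact: measurable_fun_pair.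
pose H' : {mfun T >-> (R * R)%type} := HB.pack H (isMeasurableFun.Build _ _ _ _ _ mH).
(* Absolute values make the integrand nonnegative on the whole plane, as Tonelli's theorem
   requires. *)
pose f (z : R * R) : \bar R := (`|z.1| * `|z.2|)%:E.
have mf : measurable_fun setT f.
  apply/measurable_EFinP; apply: measurable_funM; apply: measurableT_comp => //.
have f0 z : 0 <= f z by rewrite lee_fin mulr_ge0.
transitivity (\int[P]_x (f \o H) x).
  by apply: eq_integral => x _; rewrite /f/= !ger0_norm.
have -> : \int[P]_x (f \o H) x = \int[pushforward P H]_z f z.
  by rewrite ge0_integral_pushforward// preimage_setT.
have -> : \int[pushforward P H]_z f z =
    \int[(distribution P F' \x distribution P G')%E]_z f z.
  apply: (@eq_measure_integral _ _ _ setT _ (distribution P H')) => B mB _.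
  apply/esym; exact: product_measure_unique.
rewrite fubini_tonelli1//.
have mabs : measurable_fun setT (fun y : R => (`|y|%R)%:E).
  by apply/measurable_EFinP; exact: normr_measurable.
have eqG (K : {mfun T >-> R}) : (forall x, (0 <= K x)%R) ->
    \int[distribution P K]_y (`|y|%R)%:E = \int[P]_x (K x)%:E.
  move=> K0; rewrite ge0_integral_distribution//.
  by apply: eq_integral => y _ /=; rewrite ger0_norm.
have G0' : 0 <= \int[P]_y (G y)%:E by apply: integral_ge0 => y _; rewrite lee_fin.
rewrite (eq_integral (fun x : R => (`|x|%R)%:E * \int[P]_y (G y)%:E)); last first.
  move=> x _; rewrite /fubini_F /f /=.
  under eq_integral do rewrite EFinM.
  by rewrite ge0_integralZl// (eqG G').
by rewrite ge0_integralZr// (eqG F').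
Qed.

End measure_facts.

Section regenerative_chain.
Context {R : realType} {S : polishMetricType R}.
Variables (X : markov_chain S) (eta : trajectory S -> \bar R)
  (nu : probability (borel S) R).
Hypothesis Hreg : regeneration X eta nu.
Local Open Scope ereal_scope.
Local Notation T := (stopping_sequence eta).
Local Notation P := (chain_prob X nu).
Implicit Types (w : trajectory S) (A B : set (trajectory S)) (C : set (borel S)).

Let eta_stop : stopping_time eta := proj1 Hreg.

(** The future after t_k. When t_k is infinite this is w itself, on an event that [stopping_fin]
    shows to be null. *)
Definition theta k w := shift (fine (T k w)) w.

Lemma measurable_fine_stopping k : measurable_fun setT (fun w => fine (T k w)).
Proof. by apply: measurableT_comp => //; exact: measurable_stopping_sequence. Qed.

Lemma fine_stopping_ge0 k w : (0 <= fine (T k w))%R.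
Proof. by apply: fine_ge0; exact: stopping_sequence_ge0. Qed.

Lemma measurable_theta k : measurable_fun setT (theta k).
Proof.
apply: measurable_random_shift => //.
  exact: fine_stopping_ge0.
exact: measurable_fine_stopping.
Qed.

Lemma measurable_position k C : measurable C ->
  measurable [set w : trajectory S | C (w (fine (T k w)))].
Proof.
move=> mC; apply: (@measurable_random_time R S _ _ _ id C) => //.
  exact: fine_stopping_ge0.
exact: measurable_fine_stopping.
Qed.

Lemma stopping_sequence1 w : T 1 w = eta w.
Proof. by rewrite /= shift0 add0e. Qed.

Lemma measurable_stopping_fin k : measurable [set w : trajectory S | T k w < +oo].
Proof.
rewrite -[X in measurable X]setTI; apply: emeasurable_fun_infty_o => //.
exact: measurable_stopping_sequence.
Qed.

Lemma measurable_regeneration_event C : measurable C ->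
  measurable (regeneration_event eta C).
Proof.
move=> mC; have := measurableI _ _ (measurable_stopping_fin 1) (measurable_position 1 mC).
under eq_set do rewrite stopping_sequence1.
by under [X in _ `&` X]eq_set do rewrite stopping_sequence1.
Qed.

(** Regeneration is applied to the Dirac mass at x as initial law. *)
Lemma regeneration_point x C : measurable C ->
  chain_law X x (regeneration_event eta C) = nu C.
Proof.
move=> mC; have [_ /(_ (\d_x : probability _ _))[_ + _]] := Hreg.
move=> /(_ C mC) <-.
have mf := measurable_kernel (chain_law X) _ (measurable_regeneration_event mC).
have := integral_dirac x measurableT mf.
by rewrite diracT mul1e.
Qed.

Lemma stopping_finS k w : T k.+1 w < +oo <->
  T k w < +oo /\ regeneration_event eta setT (theta k w).
Proof.
rewrite /regeneration_event /theta /=.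
have := stopping_sequence_ge0 eta_stop k w.
case: (T k w) => [r| |]//= _; last by split=> [|[]].
rewrite ltry; have [e0 _] := eta_stop; have := e0 (shift r w).
by case: (eta _) => [s| |]//= _; rewrite ?ltry; split=> // -[_ []].
Qed.

Lemma position_next k w : T k.+1 w < +oo ->
  theta k w (fine (eta (theta k w))) = w (fine (T k.+1 w)).
Proof.
rewrite /theta /=.
have := stopping_sequence_ge0 eta_stop k w; case: (T k w) => [r| |]//= _.
have [e0 _] := eta_stop; have := e0 (shift r w).
by case: (eta _) => [s| |]//= s0 _; rewrite shiftE.
Qed.

(** By the strong Markov property at t_k, the conditional probability of the event given the past is
    the probability of regenerating in C from X(t_k), which is nu C wherever X(t_k) is. *)
Lemma position_indep_aux k A C : stopped_past (T k) A -> measurable C ->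
  P (A `&` [set w : trajectory S | T k.+1 w < +oo /\ C (w (fine (T k.+1 w)))]) =
  P (A `&` [set w | T k w < +oo]) * nu C.
Proof.
move=> sA mC; have := chain_strong_markov X nu
  (stopping_sequence_stopping_time eta_stop k) sA (measurable_regeneration_event mC).
under eq_integral do rewrite regeneration_point//.
rewrite integral_cst; last first.
  by apply: measurableI; [case: sA|exact: measurable_stopping_fin].
rewrite muleC => <-; congr (P _); apply/seteqP; split=> w /=.
  move=> [Aw [Tw Cw]]; have [Tk _] := stopping_finS k w; have [Tk1 [Tk2 _]] := Tk Tw.
  by split=> //; split=> //; rewrite -/(theta k w) position_next.
move=> [[Aw Tk] [h1 h2]]; split=> //; have Tk1 : T k.+1 w < +oo.
  by apply/stopping_finS; split=> //; split.
by split=> //; rewrite -position_next.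
Qed.

Lemma stopped_pastT k : stopped_past (T k) setT.
Proof.
apply/stopped_pastP; [exact: stopping_sequence_stopping_time|by split].
Qed.

(** With C = setT, the preceding identity says that t_(k+1) and t_k are finite with equal
    probability. *)
Lemma stopping_fin k : P (~` [set w | T k w < +oo]) = 0.
Proof.
suff : P [set w | T k w < +oo] = 1.
  by move=> h; rewrite probability_setC ?h ?subee//; exact: measurable_stopping_fin.
elim: k => [|k IH].
  rewrite (_ : [set _ | _] = setT) ?probability_setT//.
  by apply/seteqP; split=> w //= _; rewrite ltry.
have := position_indep_aux (stopped_pastT k) (measurableT).
rewrite !setTI probability_setT mule1 IH => <-; congr (P _).
by apply/seteqP; split=> w //= [].
Qed.

Lemma position_indep k A C : stopped_past (T k) A -> measurable C ->
  P (A `&` [set w : trajectory S | C (w (fine (T k.+1 w)))]) = P A * nu C.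
Proof.
move=> sA mC; have [mA _] := sA.
rewrite -[P A](measure_setI_full mA (measurable_stopping_fin k) (stopping_fin k)).
rewrite -position_indep_aux//.
have mAC : measurable (A `&` [set w : trajectory S | C (w (fine (T k.+1 w)))]).
  by apply: measurableI => //; exact: measurable_position.
rewrite -(measure_setI_full mAC (measurable_stopping_fin k.+1) (stopping_fin k.+1)).
by congr (P _); apply/seteqP; split=> w /=; [move=> [[]]|move=> [? []]].
Qed.

(* Only 1-dependence: the past up to t_k is independent of the future after
   t_(k+1), but not of the future after t_k. *)
Lemma theta_indep k A B : stopped_past (T k) A -> measurable B ->
  P (A `&` theta k.+1 @^-1` B) = P A * P B.
Proof.
move=> sA mB; have [mA _] := sA.
have mAB : measurable (A `&` theta k.+1 @^-1` B).
  apply: measurableI => //; rewrite -[X in measurable X]setTI.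
  exact: measurable_theta.
have mf := measurable_stopping_fin k.+1.
rewrite -(measure_setI_full mAB mf (stopping_fin k.+1)).
(* The strong Markov property at t_(k+1) turns the future event into a function of X(t_(k+1)), which
   has law nu and is independent of A by [position_indep]. *)
have := chain_strong_markov X nu (stopping_sequence_stopping_time eta_stop k.+1)
  (stopped_past_le eta_stop (leqnSn k) sA) mB.
rewrite setIAC => e; apply: (etrans e) => {e}.
have mZ : measurable_fun setT (fun w : trajectory S => w (fine (T k.+1 w)) : borel S).
  by move=> _ C mC; rewrite setTI; exact: measurable_position.
have PA : P A \is a fin_num by exact: fin_num_measure.
have PA0 : (0 <= fine (P A))%R by exact: fine_ge0.
rewrite (@ge0_integral_indep_set _ _ _ _ _ P nu (A `&` [set w | T k.+1 w < +oo])
  (NngNum PA0) (fun w => w (fine (T k.+1 w))) (fun x => chain_law X x B))//=.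
- by rewrite fineK.
- exact: measurableI.
- exact: measurable_kernel.
- move=> C mC; rewrite fineK// -(position_indep sA mC) setIAC; apply: measure_setI_full => //.
  + by apply: measurableI => //; exact: (measurable_position k.+1 mC).
  + exact: (stopping_fin k.+1).
Qed.

Lemma theta_law k B : measurable B -> P (theta k @^-1` B) = P B.
Proof.
case: k => [_|k mB].
  by congr (P _); apply/seteqP; split=> w; rewrite /theta /preimage /= shift0.
have := theta_indep (stopped_pastT k) mB.
by rewrite setTI probability_setT mul1e.
Qed.

Lemma integral_theta k (g : trajectory S -> \bar R) :
  measurable_fun setT g -> (forall w, 0 <= g w) ->
  \int[P]_w g (theta k w) = \int[P]_w g w.
Proof.
move=> mg g0.
have := @ge0_integral_indep_set _ _ _ _ _ P P setT (1%:nng)%R (theta k) g measurableT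
  (measurable_theta k) mg g0; rewrite /= mul1e; apply => B mB.
by rewrite setTI mul1e; exact: theta_law.
Qed.

Lemma integral_theta_indep k A (g : trajectory S -> \bar R) :
  stopped_past (T k) A -> measurable_fun setT g -> (forall w, 0 <= g w) ->
  \int[P]_(w in A) g (theta k.+1 w) = P A * \int[P]_w g w.
Proof.
move=> sA mg g0; have [mA _] := sA.
have PA : P A \is a fin_num by exact: fin_num_measure.
have PA0 : (0 <= fine (P A))%R by exact: fine_ge0.
have := @ge0_integral_indep_set _ _ _ _ _ P P A (NngNum PA0) (theta k.+1) g mA
  (measurable_theta k.+1) mg g0; rewrite /= fineK//; apply => B mB.
exact: theta_indep.
Qed.

Lemma integral_mul_theta k (F g : trajectory S -> R) :
  measurable_fun setT F -> measurable_fun setT g ->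
  (forall w, (0 <= F w)%R) -> (forall w, (0 <= g w)%R) ->
  (forall D : set R, measurable D -> stopped_past (T k) (F @^-1` D)) ->
  \int[P]_w (F w * g (theta k.+1 w))%:E = \int[P]_w (F w)%:E * \int[P]_w (g w)%:E.
Proof.
move=> mF mg F0 g0 sF; have mth := measurable_theta k.+1.
rewrite ge0_integral_mul_indep//.
- by congr (_ * _); apply: (@integral_theta k.+1 (EFin \o g)) => //; exact/measurable_EFinP.
- exact: measurableT_comp.
- move=> D E mD mE; have mgE : measurable (g @^-1` E).
    by rewrite -[X in measurable X]setTI; exact: mg.
  have e : P ((fun w => g (theta k.+1 w)) @^-1` E) = P (g @^-1` E).
    exact: (theta_law k.+1 mgE).
  by rewrite e; apply: (theta_indep _ mgE); exact: sF.
Qed.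

End regenerative_chain.

(** * Excursions without a hit *)

Section no_hit_probability.
Context {R : realType} {S : polishMetricType R}.
Variables (X : markov_chain S) (eta : trajectory S -> \bar R)
  (nu : probability (borel S) R) (A : set (borel S)).
Hypotheses (Hreg : regeneration X eta nu) (mA : measurable A).
Local Notation T := (stopping_sequence eta).
Local Notation P := (chain_prob X nu).

Let eta_stop : stopping_time eta := proj1 Hreg.

Definition no_hit_prob k : R := fine (P (no_hit eta A k)).
Local Notation q := no_hit_prob.

Lemma no_hit_probE k : P (no_hit eta A k) = (q k)%:E.
Proof. by rewrite /q fineK// fin_num_measure//; exact: measurable_no_hit. Qed.

Lemma no_hit_prob_ge0 k : 0 <= q k.
Proof. exact: fine_ge0. Qed.

Lemma no_hit_prob0 : q 0 = 1.
Proof. by rewrite /q no_hit0 probability_setT. Qed.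

Lemma no_hit_prob_le1 k : q k <= 1.
Proof. by rewrite -lee_fin -no_hit_probE probability_le1//; exact: measurable_no_hit. Qed.

Lemma hitting_index_prob k :
  P [set w | (hitting_index A eta w <= k%:R%:E)%E] = (1 - q k)%:E.
Proof.
rewrite hitting_index_leE// probability_setC ?no_hit_probE//.
exact: measurable_no_hit.
Qed.

Lemma excursion_hit_probE : excursion_hit_prob X eta nu A = (1 - q 1)%:E.
Proof.
rewrite -hitting_index_prob hitting_index_leE//; congr (P _).
apply/seteqP; split=> w.
  by move=> h; apply/negP; rewrite -ltNge stopping_sequence1; apply/hitting_time_ltP.
by move=> /negP; rewrite -ltNge stopping_sequence1 => /hitting_time_ltP.
Qed.

Let mnh := measurable_no_hit eta_stop mA.

Let mth k B : measurable B -> measurable (theta eta k @^-1` B).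
Proof. by move=> mB; rewrite -[X in measurable X]setTI; exact: (measurable_theta Hreg). Qed.

(** The excursion between t_a and t_(a+1) is ignored: what precedes it and what follows it are
    independent. *)
Lemma no_hit_prob_mul_ge a b : q (a.+1 + b) <= q a * q b.
Proof.
rewrite -lee_fin EFinM -!no_hit_probE.
rewrite -(theta_indep Hreg (no_hit_stopped_past eta_stop mA a) (mnh b)).
have mf := measurable_stopping_fin Hreg a.+1.
rewrite -(measure_setI_full (mnh (a.+1 + b)) mf (stopping_fin Hreg a.+1)).
apply: le_measure; rewrite ?inE.
- exact: measurableI.
- by apply: measurableI => //; exact: mth.
move=> w [h Tw]; have [+ _] := no_hitD A eta_stop b Tw => /(_ h)[h1 h2].
by split=> //; exact: no_hitS_le h1.
Qed.

(** If there is no hit on either side of the ignored excursion, only that excursion can contain one,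
    and by [theta_law] it does so with probability 1 - [q 1]. *)
Lemma no_hit_prob_mul_le a b : q a * q b <= q (a.+1 + b) + (1 - q 1).
Proof.
rewrite -lee_fin EFinM EFinD -hitting_index_prob hitting_index_leE// -!no_hit_probE.
rewrite -(theta_indep Hreg (no_hit_stopped_past eta_stop mA a) (mnh b)).
have mf := measurable_stopping_fin Hreg a.+1.
have m1 : measurable (theta eta a @^-1` (~` no_hit eta A 1)).
  by apply: mth; exact: measurableC.
have m2 : measurable (no_hit eta A a `&` theta eta a.+1 @^-1` no_hit eta A b).
  by apply: measurableI => //; exact: mth.
rewrite -(theta_law Hreg a (measurableC (mnh 1))).
rewrite -(measure_setI_full m2 mf (stopping_fin Hreg a.+1)).
apply: (le_trans _ (measureU2 _ (mnh _) m1)).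
apply: le_measure; rewrite ?inE.
- exact: measurableI.
- exact: measurableU.
move=> w [[h1 h2] Tw]; have Ta : (T a w < +oo)%E.
  by apply: le_lt_trans Tw; exact: stopping_sequence_le.
have [h3|h3] := pselect (no_hit eta A 1 (theta eta a w)); [left|by right].
apply/(no_hitD A eta_stop b Tw); split=> //.
by rewrite -addn1; apply/(no_hitD A eta_stop 1 Ta).
Qed.

Lemma no_hit_prob_expr_ge n k : q (k * n.+1) <= q n ^+ k.
Proof.
elim: k => [|k IH]; first by rewrite mul0n no_hit_prob0 expr0.
rewrite mulSn exprS (le_trans (no_hit_prob_mul_ge _ _))//.
by rewrite ler_wpM2l// no_hit_prob_ge0.
Qed.

(** The k + 1 blocks of n excursions need only k gaps. The excursion thus saved is the gap before
    the next block in [integral_no_hit_block]. *)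
Lemma no_hit_prob_expr_geS n k : q (k * n.+1 + n) <= q n ^+ k.+1.
Proof.
elim: k => [|k IH]; first by rewrite mul0n expr1.
rewrite mulSn -addnA exprS (le_trans (no_hit_prob_mul_ge _ _))//.
by rewrite ler_wpM2l// no_hit_prob_ge0.
Qed.

(** Each gap costs at most 1 - [q 1], and the costs add up because [q n] is at most 1. *)
Lemma no_hit_prob_expr_le n k : q n ^+ k <= q (k * n.+1) + k%:R * (1 - q 1).
Proof.
have p0 : 0 <= 1 - q 1 by rewrite subr_ge0 no_hit_prob_le1.
elim: k => [|k IH]; first by rewrite mul0n no_hit_prob0 expr0 mul0r addr0.
have h := no_hit_prob_mul_le n (k * n.+1).
rewrite mulSn exprS -natr1 mulrDl mul1r.
have : q n * q n ^+ k <= q n * (q (k * n.+1) + k%:R * (1 - q 1)).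
  by rewrite ler_wpM2l// no_hit_prob_ge0.
rewrite mulrDr => h2.
have : q n * (k%:R * (1 - q 1)) <= 1 * (k%:R * (1 - q 1)).
  by rewrite ler_wpM2r ?no_hit_prob_le1// mulr_ge0.
by lra.
Qed.

End no_hit_probability.

(** * Law of large numbers for blocks of excursions *)

Section markov_inequality.
Context d (T : measurableType d) (R : realType).
Local Open Scope ereal_scope.

Lemma ge0_markov (P : {measure set T -> \bar R}) (f : T -> \bar R) (a : R) :
  (0 <= a)%R -> measurable_fun setT f -> (forall x, 0 <= f x) ->
  a%:E * P [set x | a%:E <= f x] <= \int[P]_x f x.
Proof.
move=> a0 mf f0; have mD : measurable [set x | a%:E <= f x].
  by rewrite -[X in measurable X]setTI; exact: emeasurable_fun_c_infty.
rewrite -(integral_cst P mD a%:E).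
apply: (@le_trans _ _ (\int[P]_(x in [set x | a%:E <= f x]) f x)).
  apply: ge0_le_integral => //; exact: measurable_funTS.
exact: ge0_subset_integral.
Qed.

Lemma probability_integral_cst (P : probability T R) (r : \bar R) :
  \int[P]_x r = r.
Proof.
by rewrite (eq_integral (cst r))// integral_cst// [X in _ * X](probability_setT P) mule1.
Qed.

Lemma integral_le_cst (P : probability T R) (f : T -> R) (K : R) :
  measurable_fun setT f -> (forall x, (0 <= f x)%R) -> (forall x, (f x <= K)%R) ->
  \int[P]_x (f x)%:E <= K%:E.
Proof.
move=> mf f0 fK; rewrite -[leRHS](probability_integral_cst P).
apply: ge0_le_integral => //.
- by move=> x _; rewrite lee_fin.
- exact/measurable_EFinP.
- by move=> x _; rewrite lee_fin.
Qed.

End markov_inequality.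

Section blocks.
Context {R : realType} {S : polishMetricType R}.
Variables (X : markov_chain S) (eta : trajectory S -> \bar R)
  (nu : probability (borel S) R).
Hypotheses (Hreg : regeneration X eta nu).
Local Notation T := (stopping_sequence eta).
Local Notation P := (chain_prob X nu).

Let eta_stop : stopping_time eta := proj1 Hreg.
Let T0 k w : (0 <= T k w)%E := stopping_sequence_ge0 eta_stop k w.
Let mT k : measurable_fun setT (T k) := measurable_stopping_sequence eta_stop k.

(** Freezing changes neither t_a nor t_(a+b); as t_a is finite, it can be subtracted. *)
Lemma theta_stop a b t w : (T (a + b) w <= t%:E)%E ->
  T b (theta eta a (stop t w)) = T b (theta eta a w).
Proof.
move=> h; have ha : (T a w <= t%:E)%E.
  by apply: le_trans h; apply: stopping_sequence_le => //; exact: leq_addr.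
have ea := stopping_sequence_stop eta_stop ha.
have eab := stopping_sequence_stop eta_stop h.
have fa : (T a w < +oo)%E by exact: le_lt_trans ha (ltry _).
have fa' : (T a (stop t w) < +oo)%E by rewrite ea.
have faf : T a w \is a fin_num by rewrite ge0_fin_numE.
move: eab; rewrite !stopping_sequenceD// -/(theta eta a w) -/(theta eta a _) ea.
by move=> /(congr1 (fun z => z - T a w)%E); rewrite ![(T a w + _)%E]addeC !addeK.
Qed.

Variable n : nat.

Section bounded_reward.
Variables (u : \bar R -> R) (K : R).
Hypotheses (mu : measurable_fun setT u) (u0 : forall x, 0 <= u x)
  (uK : forall x, u x <= K).

Let U w := u (T n.+1 w).
(** A bounded function u of the block durations is summed: it has the second moments that the
    durations may lack. Later u is a truncation. *)
Definition block_sum k (w : trajectory S) : R :=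
  \sum_(j < k) u (T n.+1 (theta eta (j * n.+1) w)).
Local Notation Sm := block_sum.
Let c : R := fine (\int[P]_w (U w)%:E).

Let K0 : 0 <= K := le_trans (u0 0%E) (uK 0%E).
Let mU : measurable_fun setT U.
Proof. exact: measurableT_comp. Qed.

Let mUth j : measurable_fun setT (fun w => U (theta eta j w)).
Proof. by apply: measurableT_comp => //; exact: (measurable_theta Hreg). Qed.

Lemma block_sum_ge0 k w : 0 <= Sm k w.
Proof. exact: sumr_ge0. Qed.

Lemma measurable_block_sum k : measurable_fun setT (Sm k).
Proof. by apply: measurable_sum => j; exact: mUth. Qed.

Lemma block_sumS k w : Sm k.+1 w = Sm k w + U (theta eta (k * n.+1) w).
Proof. by rewrite /block_sum big_ord_recr. Qed.

Lemma block_mean_fin : (\int[P]_w (U w)%:E)%E = c%:E.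
Proof.
rewrite fineK// ge0_fin_numE; last by apply: integral_ge0 => w _; rewrite lee_fin u0.
by apply: le_lt_trans (ltry K); apply: integral_le_cst => // w; [exact: u0|exact: uK].
Qed.

Let c0 : 0 <= c.
Proof. by apply: fine_ge0; apply: integral_ge0 => w _; rewrite lee_fin u0. Qed.

Lemma integral_block j : (\int[P]_w (U (theta eta j w))%:E)%E = c%:E.
Proof.
rewrite -block_mean_fin; apply: (integral_theta Hreg j (g := EFin \o U)).
  exact/measurable_EFinP.
by move=> w; rewrite lee_fin u0.
Qed.

Lemma integral_block_sum k : (\int[P]_w (Sm k w)%:E)%E = (k%:R * c)%:E.
Proof.
elim: k => [|k IH].
  by rewrite mul0r; apply: integral0_eq => w _; rewrite /block_sum big_ord0.
under eq_integral do rewrite block_sumS EFinD.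
rewrite ge0_integralD//=.
- by rewrite IH integral_block -EFinD -natr1 mulrDl mul1r.
- by move=> w _; rewrite lee_fin block_sum_ge0.
- by apply/measurable_EFinP; exact: measurable_block_sum.
- by move=> w _; rewrite lee_fin u0.
- exact/measurable_EFinP.
Qed.

Lemma block_sum_stopped_past k (D : set R) : measurable D ->
  stopped_past (T (k * n.+1)) (Sm k @^-1` D).
Proof.
move=> mD; apply/stopped_pastP; first exact: stopping_sequence_stopping_time.
split.
  by rewrite -[X in measurable X]setTI; exact: measurable_block_sum.
move=> t w h; rewrite /preimage /mkset; suff -> : Sm k (stop t w) = Sm k w by [].
apply: eq_bigr => j _; rewrite (@theta_stop (j * n.+1) n.+1 t w)//.
apply: le_trans h; apply: stopping_sequence_le => //.
by rewrite addnC -mulSn leq_mul2r ltn_ord orbT.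
Qed.

(** Adding a block of value v after one of value b to a sum a increases the square by 2av + 2bv +
    v^2. Here a and v are independent, since the block of b separates them, and the other terms are
    at most 3 K^2. *)
Lemma integral_block_sum_sqr k :
  (\int[P]_w ((Sm k w) ^+ 2)%:E <= (k%:R ^+ 2 * c ^+ 2 + 3 * k%:R * K ^+ 2)%:E)%E.
Proof.
have mS := measurable_block_sum.
have mS2 j : measurable_fun setT (fun w => ((Sm j w) ^+ 2)%:E).
  by apply/measurable_EFinP; apply: measurable_funX.
elim: k => [|[|k] IH].
- rewrite expr0n mulr0 !mul0r addr0 integral0_eq// => w _.
  by rewrite /block_sum big_ord0 expr0n.
- apply: (@le_trans _ _ (K ^+ 2)%:E).
    apply: integral_le_cst; first exact: measurable_funX.
      by move=> w; exact: sqr_ge0.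
    by move=> w; rewrite /block_sum big_ord1 ler_pXn2r ?nnegrE ?u0 ?uK.
  rewrite lee_fin expr1n !mul1r mulr1; have := sqr_ge0 c; have := sqr_ge0 K; lra.
pose V w := U (theta eta (k.+1 * n.+1) w).
have V0 w : 0 <= V w by exact: u0.
have crossE : (\int[P]_w (Sm k w * V w)%:E)%E = (k%:R * c * c)%:E.
  have e : (k.+1 * n.+1 = (k * n.+1 + n).+1)%N by rewrite mulSn addnC addnS.
  rewrite /V e (integral_mul_theta Hreg (F := Sm k) (g := U))//.
  - by rewrite integral_block_sum block_mean_fin -EFinM.
  - exact: block_sum_ge0.
  - by move=> w; exact: u0.
  - move=> D mD; apply: (stopped_past_le eta_stop (leq_addr n _)).
    exact: block_sum_stopped_past.
have pw w : (Sm k.+2 w) ^+ 2 <= (Sm k.+1 w) ^+ 2 + (2 * (Sm k w * V w) + 3 * K ^+ 2).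
  rewrite block_sumS -/(V w) (block_sumS k).
  set a := Sm k w; set b := U _; set v := V w.
  have b0 : 0 <= b by exact: u0.
  have bK : b <= K by exact: uK.
  have v0 : 0 <= v by exact: u0.
  have vK : v <= K by exact: uK.
  have h1 : b * v <= K * K by rewrite ler_pM.
  have h2 : v * v <= K * K by rewrite ler_pM.
  by rewrite !expr2; nra.
have mSV : measurable_fun setT (fun w => (Sm k w * V w)%:E).
  by apply/measurable_EFinP; apply: measurable_funM => //; exact: mUth.
have SV0 w : (0 <= (Sm k w * V w)%:E)%E by rewrite lee_fin mulr_ge0// block_sum_ge0.
have K20 : (0 <= (3 * K ^+ 2)%:E)%E by rewrite lee_fin mulr_ge0// sqr_ge0.
apply: (@le_trans _ _ (\int[P]_w (((Sm k.+1 w) ^+ 2)%:E +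
    (2%:E * (Sm k w * V w)%:E + (3 * K ^+ 2)%:E)))%E).
  apply: ge0_le_integral => //.
  - by move=> w _; rewrite lee_fin sqr_ge0.
  - apply: emeasurable_funD => //; apply: emeasurable_funD => //.
    exact: measurable_funeM.
  - by move=> w _; rewrite -EFinM -!EFinD lee_fin.
rewrite ge0_integralD//; last 3 first.
- by move=> w _; rewrite lee_fin sqr_ge0.
- by move=> w _; rewrite adde_ge0// mule_ge0// lee_fin.
- by apply: emeasurable_funD => //; exact: measurable_funeM.
rewrite ge0_integralD//; last 2 first.
- by move=> w _; rewrite mule_ge0// lee_fin.
- exact: measurable_funeM.
rewrite ge0_integralZl//.
rewrite crossE probability_integral_cst -EFinM -EFinD.
apply: le_trans (leeD2r _ IH) _.
rewrite -EFinD lee_fin -!natr1; have := sqr_ge0 c; rewrite !expr2 => ?.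
by nra.
Qed.

Lemma block_sum_chebyshev k a : 0 < a ->
  (P [set w | (a <= `|Sm k w - k%:R * c|)%R] <= (3 * k%:R * K ^+ 2 / a ^+ 2)%:E)%E.
Proof.
move=> a0; set x := k%:R * c.
have x0 : 0 <= x by rewrite mulr_ge0.
have mS := measurable_block_sum k.
have mZ : measurable_fun setT (fun w => (((Sm k w - x) ^+ 2)%:E)).
  apply/measurable_EFinP; apply: measurable_funX; exact: measurable_funB.
have Z0 w : (0 <= ((Sm k w - x) ^+ 2)%:E)%E by rewrite lee_fin sqr_ge0.
have mS2 : measurable_fun setT (fun w => ((Sm k w) ^+ 2)%:E).
  by apply/measurable_EFinP; apply: measurable_funX.
(* The expansion of the square, with x the mean of [Sm k], is arranged so that all extended-valued
   integrands are nonnegative and nothing is subtracted. *)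
have sum_eq : (\int[P]_w ((Sm k w - x) ^+ 2)%:E + (2 * x * x)%:E =
    \int[P]_w ((Sm k w) ^+ 2)%:E + (x ^+ 2)%:E)%E.
  have := integral_block_sum k; rewrite -/x => ES.
  have -> : ((2 * x * x)%:E = \int[P]_w ((2 * x)%:E * (Sm k w)%:E))%E.
    rewrite ge0_integralZl ?lee_fin//; last 3 first.
    - exact/measurable_EFinP.
    - by move=> w _; rewrite lee_fin block_sum_ge0.
    - by rewrite mulr_ge0.
    by rewrite ES -EFinM.
  have -> : ((x ^+ 2)%:E = \int[P]_w (x ^+ 2)%:E)%E by rewrite probability_integral_cst.
  rewrite -!ge0_integralD//; last 4 first.
  - by move=> w _; rewrite lee_fin sqr_ge0.
  - by move=> w _; rewrite lee_fin sqr_ge0.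
  - by move=> w _; rewrite -EFinM lee_fin !mulr_ge0// block_sum_ge0.
  - by apply: measurable_funeM; exact/measurable_EFinP.
  apply: eq_integral => w _; rewrite -EFinM -!EFinD; congr (_%:E).
  by rewrite !expr2; ring.
have bound : (\int[P]_w ((Sm k w - x) ^+ 2)%:E <= (3 * k%:R * K ^+ 2)%:E)%E.
  have := integral_block_sum_sqr k; move: sum_eq.
  case: (\int[P]_w ((Sm k w - x) ^+ 2)%:E)%E => [z| |]; last by move=> *; exact: leNye.
    case: (\int[P]_w ((Sm k w) ^+ 2)%:E)%E => [s| |]//.
    rewrite -!EFinD !lee_fin => -[zs]; rewrite -exprMn -/x => h.
    by move: zs h; rewrite !expr2; nra.
  by case: (\int[P]_w ((Sm k w) ^+ 2)%:E)%E => [s| |].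
rewrite EFinM lee_pdivlMr ?exprn_gt0// muleC; apply: (le_trans _ bound).
have := ge0_markov P (sqr_ge0 a) mZ Z0; congr (_ * P _ <= _)%E.
apply: eq_set => w; rewrite lee_fin -[(Sm k w - x) ^+ 2]real_normK ?num_real//.
by rewrite ler_pXn2r// nnegrE ltW.
Qed.

End bounded_reward.

End blocks.

(** * Truncation of durations *)

Section truncation.
Context {R : realType}.
Variable M : R.
Hypothesis M0 : 0 <= M.
Local Open Scope ereal_scope.

(** The maximum with 0 makes this nonnegative on all of \bar R, as block sums require of u. *)
Definition trunc_part (x : \bar R) : R := fine (maxe 0 (mine x M%:E)).
Definition excess_part (x : \bar R) : \bar R := maxe 0 (x - M%:E).

Lemma trunc_part_ge0 x : (0 <= trunc_part x)%R.
Proof. by apply: fine_ge0; rewrite le_max lexx. Qed.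

Lemma trunc_part_le x : (trunc_part x <= M)%R.
Proof.
rewrite -lee_fin /trunc_part fineK; last first.
  rewrite ge0_fin_numE ?le_max ?lexx// gt_max ltry/= gt_min ltry orbT//.
by rewrite ge_max lee_fin M0 /= ge_min lexx orbT.
Qed.

Lemma trunc_excess x : 0 <= x -> x = (trunc_part x)%:E + excess_part x.
Proof.
rewrite /trunc_part /excess_part; case: x => [x| |]//=; last first.
  by move=> _; rewrite addye// /maxe /= ?ltry// addey.
rewrite lee_fin => x0; rewrite -EFinB -EFin_min -!EFin_max /= -EFinD; congr (_%:E).
have [xM|Mx] := leP x M.
  by rewrite max_r// max_l ?addr0// subr_le0.
by rewrite max_r// max_r ?subrKC// subr_ge0 ltW.
Qed.

Lemma measurable_trunc_part : measurable_fun setT trunc_part.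
Proof.
apply: measurableT_comp => //; apply: measurable_maxe => //.
exact: measurable_mine.
Qed.

Lemma excess_part_ge0 x : 0 <= excess_part x.
Proof. by rewrite /excess_part le_max lexx. Qed.

Lemma measurable_excess_part : measurable_fun setT excess_part.
Proof.
apply: measurable_maxe => //; exact: emeasurable_funB.
Qed.

Lemma excess_part_eq0 x : x <= M%:E -> excess_part x = 0.
Proof. by move=> xM; apply/max_l; rewrite sube_le0. Qed.

Lemma excess_part_le x : 0 <= x -> excess_part x <= x.
Proof. by move=> x0; rewrite ge_max x0 leeBlDr// leeDl// lee_fin. Qed.

End truncation.

(** * Deviations of the total duration of k blocks *)

Section block_law_of_large_numbers.
Context {R : realType} {S : polishMetricType R}.
Variables (X : markov_chain S) (eta : trajectory S -> \bar R)
  (nu : probability (borel S) R).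
Hypotheses (Hreg : regeneration X eta nu).
Local Notation T := (stopping_sequence eta).
Local Notation P := (chain_prob X nu).
Implicit Types w : trajectory S.

Let eta_stop : stopping_time eta := proj1 Hreg.
Let T0 k w : (0 <= T k w)%E := stopping_sequence_ge0 eta_stop k w.
Let mT k : measurable_fun setT (T k) := measurable_stopping_sequence eta_stop k.

Let mTth k b : measurable_fun setT (fun w => T b (theta eta k w)).
Proof. by apply: measurableT_comp => //; exact: (measurable_theta Hreg). Qed.

(** The future after t_k again has law P, so all increments have the mean of eta; linearity suffices
    despite the dependence, also for infinite means. *)
Lemma integral_stopping_sequence k :
  (\int[P]_w T k w = k%:R%:E * \int[P]_w eta w)%E.
Proof.
elim: k => [|k IH]; first by rewrite mul0e; exact: integral0_eq.
have e0 : (0 <= \int[P]_w eta w)%E by apply: integral_ge0 => w _; case: eta_stop.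
have mf := measurable_stopping_fin Hreg k; have Pf := stopping_fin Hreg k.
have -> : (\int[P]_w T k.+1 w = \int[P]_w (T k w + T 1 (theta eta k w)))%E.
  rewrite (ge0_integral_full mf Pf (mT k.+1) (T0 k.+1)).
  rewrite [RHS](ge0_integral_full mf Pf); last 2 first.
  - exact: emeasurable_funD.
  - by move=> w; rewrite adde_ge0.
  by apply: eq_integral => w /[!inE] h; rewrite -addn1 stopping_sequenceD.
rewrite ge0_integralD// IH (integral_theta Hreg k (g := T 1))//.
under [X in (_ + X)%E]eq_integral do rewrite stopping_sequence1.
by rewrite -natr1 EFinD ge0_muleDl// mul1e.
Qed.

Lemma integral_eta_gt0 : (0 < \int[P]_w eta w)%E.
Proof.
have [e0 _] := eta_stop; have [_ /(_ nu)[aepos _ _]] := Hreg.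
have me : measurable_fun setT eta by have /stopping_timeP[] := eta_stop.
rewrite lt_neqAle integral_ge0// andbT; apply/eqP => /esym h.
have : (\int[P]_w `|eta w| = 0)%E by rewrite -h; apply: eq_integral => w _; rewrite gee0_abs.
move=> /(ae_eq_integral_abs _ measurableT me) h0.
have : (\forall w \ae P, False)%classic.
  by apply: filterS2 aepos h0 => w epos /(_ I) ew; move: epos; rewrite ew ltxx.
move=> [N [mN N0 sub]]; have : P setT = 0%E.
  apply/eqP; rewrite eq_le measure_ge0 andbT -N0; apply: le_measure; rewrite ?inE//.
  by move=> w _; apply: sub => /=.
by rewrite probability_setT => /eqP; rewrite onee_eq0.
Qed.

Variable n : nat.

Lemma stopping_sequence_blocks k w : (T (k * n.+1) w < +oo)%E ->
  T (k * n.+1) w = (\sum_(j < k) T n.+1 (theta eta (j * n.+1) w))%E.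
Proof.
elim: k => [|k IH] h; first by rewrite big_ord0.
have hk : (T (k * n.+1) w < +oo)%E.
  by apply: le_lt_trans h; apply: stopping_sequence_le => //; rewrite leq_mul2r leqnSn orbT.
by rewrite [in LHS]mulSn [in LHS]addnC stopping_sequenceD// big_ord_recr -IH.
Qed.

Variables (mu K e : R).
Hypotheses (mu0 : 0 < mu) (K0 : 0 <= K)
  (muE : (\int[P]_w T n.+1 w)%E = mu%:E)
  (UI : (\int[P]_(w in [set w | K%:E < `|T n.+1 w / mu%:E|]) `|T n.+1 w / mu%:E|
          <= e%:E)%E).

Let M := K * mu.
Let M0 : 0 <= M. Proof. by rewrite mulr_ge0// ltW. Qed.

Let g w := excess_part M (T n.+1 w).
Let g0 w : (0 <= g w)%E := excess_part_ge0 M _.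
Let mg : measurable_fun setT g.
Proof. by apply: measurableT_comp => //; exact: measurable_excess_part. Qed.

(** The excess over K mu vanishes unless the normalized duration exceeds K, and never exceeds the
    duration itself. *)
Lemma integral_excess_le : (\int[P]_w g w <= (mu * e)%:E)%E.
Proof.
set D := [set w | (K%:E < `|T n.+1 w / mu%:E|)%E].
have divE w : (`|T n.+1 w / mu%:E| = T n.+1 w * (mu^-1)%:E)%E.
  by rewrite gee0_abs inver gt_eqF// mule_ge0// lee_fin invr_ge0 ltW.
have mulE w : (mu%:E * `|T n.+1 w / mu%:E| = T n.+1 w)%E.
  by rewrite divE muleCA -EFinM mulfV ?gt_eqF// mule1.
have mabs : measurable_fun setT (fun w => `|T n.+1 w / mu%:E|%E).
  rewrite (_ : (fun _ => _) = (fun w => T n.+1 w * (mu^-1)%:E)%E).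
    exact: emeasurable_funM.
  by apply/funext => w; rewrite divE.
have mD : measurable D.
  by rewrite -[X in measurable X]setTI; exact: emeasurable_fun_o_infty.
have -> : (\int[P]_w g w = \int[P]_(w in D) g w)%E.
  rewrite [RHS]integral_mkcond; apply: eq_integral => w _; rewrite patchE.
  case: ifPn => //; rewrite notin_setE /D /= => /negP; rewrite -leNgt => h.
  apply: excess_part_eq0; rewrite -(mulE w) /M mulrC EFinM.
  by rewrite lee_pmul2l ?lte_fin.
apply: (@le_trans _ _ (\int[P]_(w in D) (mu%:E * `|T n.+1 w / mu%:E|))%E).
  apply: ge0_le_integral => //.
  - exact: measurable_funTS.
  - by apply: measurable_funTS; exact: measurable_funeM.
  - by move=> w _; rewrite mulE; exact: excess_part_le.
rewrite ge0_integralZl//; last 2 first.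
- exact: measurable_funTS.
- by rewrite lee_fin ltW.
by rewrite EFinM lee_pmul2l ?lte_fin.
Qed.

Let mu_ := measurable_trunc_part M.
Let u0 := trunc_part_ge0 M.
Let uK := trunc_part_le M0.
Let c : R := fine (\int[P]_w (trunc_part M (T n.+1 w))%:E).
Local Notation Sm := (block_sum eta n (trunc_part M)).

Lemma trunc_mean_bounds : mu * (1 - e) <= c <= mu.
Proof.
have cE := block_mean_fin Hreg n mu_ u0 uK.
have mU : measurable_fun setT (fun w => (trunc_part M (T n.+1 w))%:E).
  by apply/measurable_EFinP; exact: measurableT_comp.
have h : (mu%:E = c%:E + \int[P]_w g w)%E.
  rewrite -muE -cE -ge0_integralD//.
    by apply: eq_integral => w _; exact: trunc_excess.
  by move=> w _; rewrite lee_fin.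
have := integral_excess_le; have : (0 <= \int[P]_w g w)%E by exact: integral_ge0.
move: h; case: (\int[P]_w g w)%E => [a| |]//= -[->]; rewrite !lee_fin => a0 ae.
by apply/andP; split; nra.
Qed.

Let W k w : \bar R := (\sum_(j < k) g (theta eta (j * n.+1) w))%E.
Let W0 k w : (0 <= W k w)%E. Proof. exact: sume_ge0. Qed.
Let mW k : measurable_fun setT (W k).
Proof.
by apply: emeasurable_sum => j; apply: measurableT_comp => //; exact: (measurable_theta Hreg).
Qed.

Lemma integral_excess_sum k : (\int[P]_w W k w <= (k%:R * (mu * e))%:E)%E.
Proof.
rewrite /W ge0_integral_sum//; last first.
  by move=> j; apply: measurableT_comp => //; exact: (measurable_theta Hreg).
apply: (@le_trans _ _ (\sum_(j < k) (mu * e)%:E)%E).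
  apply: lee_sum => j _.
  rewrite (integral_theta Hreg (j * n.+1) mg g0); exact: integral_excess_le.
by rewrite sumEFin sumr_const card_ord mulr_natl.
Qed.

Lemma blocks_trunc_excess k w : (T (k * n.+1) w < +oo)%E ->
  T (k * n.+1) w = ((Sm k w)%:E + W k w)%E.
Proof.
move=> h; rewrite stopping_sequence_blocks// /block_sum -sumEFin /W -big_split.
apply: eq_bigr => j _; apply: trunc_excess => //; exact: T0.
Qed.

Variable (eps : R).
Hypotheses (eps0 : 0 < eps) (eeps : e <= eps / 2).

Let dev k := P [set w | (k%:R * mu * (eps / 2) <= `|Sm k w - k%:R * c|)%R].

Let mdev k : measurable [set w | (k%:R * mu * (eps / 2) <= `|Sm k w - k%:R * c|)%R].
Proof.
rewrite -[X in measurable X]setTI; apply: measurable_fun_le => //.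
apply: measurableT_comp => //; apply: measurable_funB => //.
exact: (measurable_block_sum Hreg).
Qed.

Let devE k : (0 < k)%N -> (dev k <= (12 * K ^+ 2 / (k%:R * eps ^+ 2))%:E)%E.
Proof.
move=> k0; have kR : 0 < k%:R :> R by rewrite ltr0n.
have a0 : 0 < k%:R * mu * (eps / 2) by rewrite !mulr_gt0.
apply: (le_trans (block_sum_chebyshev Hreg n mu_ u0 uK k a0)).
(* Chebyshev's bound with truncation level K mu and deviation k mu eps / 2: the 12 is 3 times the 4
   from the squared half. *)
rewrite lee_fin /M le_eqVlt; apply/orP; left; apply/eqP.
by field; rewrite !gt_eqF.
Qed.

(** Durations dominate their truncations, and c >= mu (1 - eps / 2); the other half of eps is a
    deviation of the truncated sum. *)
Lemma blocks_lower_tail k : (0 < k)%N ->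
  (P [set w | T (k * n.+1) w <= ((1 - eps) * (k%:R * mu))%:E] <=
    (12 * K ^+ 2 / (k%:R * eps ^+ 2))%:E)%E.
Proof.
move=> k0; have kR : 0 < k%:R :> R by rewrite ltr0n.
apply: le_trans (devE k0); apply: le_measure; rewrite ?inE//.
  by rewrite -[X in measurable X]setTI; exact: emeasurable_fun_infty_c.
move=> w /= h; have /andP[c1 c2] := trunc_mean_bounds.
have : ((Sm k w)%:E <= ((1 - eps) * (k%:R * mu))%:E)%E.
  apply: (le_trans _ h); rewrite blocks_trunc_excess ?leeDl//.
  exact: le_lt_trans h (ltry _).
rewrite lee_fin => hS; rewrite distrC; apply: le_trans (ler_norm _).
have : k%:R * (mu * (1 - e)) <= k%:R * c by rewrite ler_pM2l.
have : k%:R * mu * e <= k%:R * mu * (eps / 2) by rewrite ler_pM2l// mulr_gt0.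
by move: hS; nra.
Qed.

(** As c <= mu, half of the surplus k mu eps comes from the truncated sum or from the excesses; the
    latter, of mean at most k mu e, are handled by Markov's inequality, whence 2 e / eps. *)
Lemma blocks_upper_tail k : (0 < k)%N ->
  (P [set w | ((1 + eps) * (k%:R * mu))%:E < T (k * n.+1) w] <=
    (12 * K ^+ 2 / (k%:R * eps ^+ 2) + 2 * e / eps)%:E)%E.
Proof.
move=> k0; have kR : 0 < k%:R :> R by rewrite ltr0n.
set D := [set w | _].
have a0 : 0 < k%:R * mu * (eps / 2) by rewrite !mulr_gt0.
have mD : measurable D.
  by rewrite -[X in measurable X]setTI; exact: emeasurable_fun_o_infty.
have mE : measurable [set w | ((k%:R * mu * (eps / 2))%:E <= W k w)%E].
  by rewrite -[X in measurable X]setTI; exact: emeasurable_fun_c_infty.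
have mf := measurable_stopping_fin Hreg (k * n.+1).
rewrite -(measure_setI_full mD mf (stopping_fin Hreg (k * n.+1))).
have WE : (P [set w | ((k%:R * mu * (eps / 2))%:E <= W k w)%E] <= (2 * e / eps)%:E)%E.
  have := le_trans (ge0_markov P (ltW a0) (mW k) (W0 k)) (integral_excess_sum k).
  rewrite -lee_pdivlMl// => /le_trans; apply; rewrite -EFinM lee_fin.
  rewrite le_eqVlt; apply/orP; left; apply/eqP.
  by field; rewrite !gt_eqF.
rewrite EFinD; apply: le_trans (leeD (devE k0) WE).
apply: le_trans (measureU2 _ (mdev k) mE); apply: le_measure; rewrite ?inE//.
- exact: measurableI.
- exact: measurableU.
move=> w [h fin] /=; have /andP[c1 c2] := trunc_mean_bounds.
move: h; rewrite /D /mkset blocks_trunc_excess// => h.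
have [hW|hW] := leP (k%:R * mu * (eps / 2))%:E (W k w); first by right.
left; have hWf : W k w \is a fin_num by rewrite ge0_fin_numE// (lt_trans hW) ?ltry.
move: h hW; rewrite -(fineK hWf) -EFinD !lte_fin => h hW.
apply: le_trans (ler_norm _).
have : k%:R * c <= k%:R * mu by rewrite ler_pM2l.
by move: h hW; nra.
Qed.

End block_law_of_large_numbers.

(** * Tail and mean of the hitting time *)

Section hitting_time_estimates.
Context {R : realType} {S : polishMetricType R}.
Variables (X : markov_chain S) (eta : trajectory S -> \bar R)
  (nu : probability (borel S) R) (A : set (borel S)).
Hypotheses (Hreg : regeneration X eta nu) (mA : measurable A).
Local Notation T := (stopping_sequence eta).
Local Notation P := (chain_prob X nu).
Local Notation tau := (hitting_time A).
Local Notation q := (no_hit_prob X eta nu A).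
Implicit Types w : trajectory S.

Let eta_stop : stopping_time eta := proj1 Hreg.
Let T0 k w : (0 <= T k w)%E := stopping_sequence_ge0 eta_stop k w.
Let mT k : measurable_fun setT (T k) := measurable_stopping_sequence eta_stop k.
Let mtau : measurable_fun setT tau := measurable_hitting_time mA.
Let mnh k : measurable (no_hit eta A k) := measurable_no_hit eta_stop mA k.
Let tau0 w : (0 <= tau w)%E := hitting_time_ge0 A w.

Lemma measurable_hitting_tail (y : R) : measurable [set w | (y%:E < tau w)%E].
Proof. by rewrite -[X in measurable X]setTI; exact: emeasurable_fun_o_infty. Qed.

(** A lower Riemann sum of mesh h for the integral of the tail. *)
Lemma hitting_tail_layers (h : R) I : 0 <= h ->
  (\sum_(i < I) h%:E * P [set w | (i.+1%:R * h)%:E < tau w] <= \int[P]_w tau w)%E.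
Proof.
move=> h0; pose D i := [set w | ((i.+1%:R * h)%:E < tau w)%E].
have mD i : measurable (D i) by exact: measurable_hitting_tail.
(* The cap drives the induction: when tau exceeds (J + 1) h, the first J terms still total at most J
   h. *)
have pw I' w : (\sum_(i < I') h%:E * (\1_(D i) w)%:E <= mine (tau w) (I'%:R * h)%:E)%E.
  elim: I' => [|J IH]; first by rewrite big_ord0 mul0r le_min tau0 lexx.
  rewrite big_ord_recr /=; have [t1 t2] : (\sum_(i < J) h%:E * (\1_(D i) w)%:E <= tau w)%E /\
      (\sum_(i < J) h%:E * (\1_(D i) w)%:E <= (J%:R * h)%:E)%E.
    by move: IH; rewrite le_min => /andP.
  rewrite indicE; have [/[!inE] wD|wD] := boolP (w \in D J).
    rewrite mule1; have le : (\sum_(i < J) h%:E * (\1_(D i) w)%:E + h%:E <= (J.+1%:R * h)%:E)%E.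
      by rewrite -natr1 mulrDl mul1r EFinD leeD2r.
    by rewrite le_min le andbT (le_trans le)// ltW.
  rewrite mule0 adde0 le_min t1 (le_trans t2)// lee_fin ler_wpM2r//.
  by rewrite ler_nat.
have m1D i : measurable_fun setT (fun w => (\1_(D i) w : R)%:E).
  by apply/measurable_EFinP; exact: measurable_indic.
have mhD (i : 'I_I) : measurable_fun setT (fun w => h%:E * (\1_(D i) w)%:E)%E.
  exact: measurable_funeM.
have hD0 (i : 'I_I) w : setT w -> (0 <= h%:E * (\1_(D i) w)%:E)%E.
  by move=> _; rewrite mule_ge0// lee_fin.
apply: (@le_trans _ _ (\int[P]_w \sum_(i < I) h%:E * (\1_(D i) w)%:E)%E).
  rewrite (ge0_integral_sum P measurableT mhD hD0).
  apply: lee_sum => i _; rewrite ge0_integralZl//.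
  by rewrite integral_indic// setIT.
apply: ge0_le_integral => //.
- by move=> w _; apply: sume_ge0 => i _; exact: hD0.
- exact: emeasurable_sum.
- by move=> w _; have := pw I w; rewrite le_min => /andP[].
Qed.

Variables (n : nat) (mu : R).
Hypotheses (mu0 : 0 < mu) (muE : (\int[P]_w T n.+1 w)%E = mu%:E).

Lemma integral_no_hit_block k :
  (\int[P]_(w in no_hit eta A (k * n.+1)) T n.+1 (theta eta (k * n.+1) w)
     <= (q n ^+ k * mu)%:E)%E.
Proof.
have mth j : measurable_fun setT (fun w => T n.+1 (theta eta j w)).
  by apply: measurableT_comp => //; exact: (measurable_theta Hreg).
case: k => [|k].
  by rewrite no_hit0 (integral_theta Hreg (0 * n.+1) (mT n.+1) (T0 n.+1)) muE mul1r.
have -> : (k.+1 * n.+1 = (k * n.+1 + n).+1)%N by rewrite mulSn addnC addnS.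
apply: (@le_trans _ _ (\int[P]_(w in no_hit eta A (k * n.+1 + n))
    T n.+1 (theta eta (k * n.+1 + n).+1 w))%E).
  apply: ge0_subset_integral => //; first exact: measurable_funTS.
  exact: no_hitS_le.
rewrite (integral_theta_indep Hreg (no_hit_stopped_past eta_stop mA _) (mT n.+1) (T0 n.+1)).
rewrite muE (no_hit_probE Hreg mA) -EFinM lee_fin ler_pM2r//.
exact: no_hit_prob_expr_geS.
Qed.

Hypothesis q1 : q n < 1.

(** One more block increases the minimum by at most its duration, and only if no hit has occurred;
    this sums a geometric series of ratio [q n]. *)
Lemma integral_hitting_time_min k :
  (\int[P]_w mine (tau w) (T (k * n.+1) w) <= (mu * ((1 - q n ^+ k) / (1 - q n)))%:E)%E.
Proof.
have q10 : 0 < 1 - q n by rewrite subr_gt0.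
have mth j : measurable_fun setT (fun w => T n.+1 (theta eta j w)).
  by apply: measurableT_comp => //; exact: (measurable_theta Hreg).
have mmin j : measurable_fun setT (fun w => mine (tau w) (T j w)).
  exact: measurable_mine.
have min0 j w : (0 <= mine (tau w) (T j w))%E by rewrite le_min tau0 T0.
elim: k => [|k IH].
  rewrite expr0 subrr mul0r mulr0 integral0_eq// => w _.
  by apply: min_r; exact: tau0.
pose B := (fun w => T n.+1 (theta eta (k * n.+1) w)) \_ (no_hit eta A (k * n.+1)).
have B0 w : (0 <= B w)%E by rewrite /B patchE; case: ifP.
have mB : measurable_fun setT B.
  by apply/(measurable_restrictT _ _).1 => //; exact: measurable_funTS.
apply: (@le_trans _ _ (\int[P]_w (mine (tau w) (T (k * n.+1) w) + B w))%E).
  apply: ge0_le_integral => //; first exact: emeasurable_funD.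
  move=> w _; have [lt|ge] := ltP (tau w) (T (k * n.+1) w).
    by apply: le_trans (leeDl _ (B0 w)); rewrite ge_min lexx.
  rewrite /B patchE mem_set//.
  have [Ty|Tf] := eqVneq (T (k * n.+1) w) +oo%E.
    by rewrite Ty addye ?leey// gt_eqF// (lt_le_trans _ (T0 _ _)).
  rewrite -stopping_sequenceD ?ltey// addnC -mulSn ge_min lexx orbT//.
rewrite ge0_integralD// -integral_mkcond.
apply: le_trans (leeD IH (integral_no_hit_block k)) _.
rewrite -EFinD lee_fin le_eqVlt exprS; apply/orP; left; apply/eqP.
by field; rewrite gt_eqF.
Qed.

Lemma integral_hitting_time_le : (\int[P]_w tau w <= (mu / (1 - q n))%:E)%E.
Proof.
have q10 : 0 < 1 - q n by rewrite subr_gt0.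
(* The event that some block contains a hit; its complement has probability at most [q n] ^ k for
   every k. On E the truncated times are eventually equal to tau, and monotone convergence
   applies. *)
pose E := \bigcup_k ~` no_hit eta A (k * n.+1).
have mE : measurable E by apply: bigcupT_measurable => k; exact: measurableC.
have PE : P (~` E) = 0%E.
  have PEf : P (~` E) \is a fin_num by apply: fin_num_measure; exact: measurableC.
  have le k : fine (P (~` E)) <= q n ^+ k.
    apply: le_trans (no_hit_prob_expr_ge Hreg mA n k).
    rewrite -lee_fin fineK// -(no_hit_probE Hreg mA) le_measure ?inE//.
      exact: measurableC.
    by rewrite /E setC_bigcup => w /(_ k I); rewrite setCK.
  apply/eqP; rewrite eq_le measure_ge0 andbT -(fineK PEf) lee_fin.
  have qn : `|q n| < 1 by rewrite ger0_norm ?no_hit_prob_ge0.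
  rewrite -(cvg_lim (@Rhausdorff R) (cvg_expr qn)); apply: limr_ge.
    by apply/cvg_ex; eexists; exact: cvg_expr.
  by near=> k; exact: le.
have min0 j w : (0 <= mine (tau w) (T j w))%E by rewrite le_min tau0 T0.
have mmin j : measurable_fun setT (fun w => mine (tau w) (T j w)).
  exact: measurable_mine.
rewrite (ge0_integral_full mE PE mtau tau0).
have -> : (\int[P]_(w in E) tau w = \int[P]_(w in E)
    limn (fun k => mine (tau w) (T (k * n.+1) w)))%E.
  apply: eq_integral => w /[!inE] -[k0 _ /= /negP]; rewrite -ltNge => h.
  apply/esym/cvg_lim => //; apply: cvg_near_cst; exists k0 => // k /= k0k.
  apply/eqP; rewrite /mine; apply/eqP/min_l/ltW/(lt_le_trans h).
  by apply: stopping_sequence_le => //; rewrite leq_mul2r k0k orbT.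
have nd w j k : (j <= k)%N ->
    (mine (tau w) (T (j * n.+1) w) <= mine (tau w) (T (k * n.+1) w))%E.
  move=> jk; rewrite le_min ge_min lexx /= ge_min; apply/orP; right.
  by apply: stopping_sequence_le => //; rewrite leq_mul2r jk orbT.
rewrite monotone_convergence//; last 2 first.
- by move=> k; exact: measurable_funTS.
- by move=> w _ j k; exact: nd.
apply: lime_le.
  apply: ereal_nondecreasing_is_cvgn => j k jk; apply: ge0_le_integral => //.
  - exact: measurable_funTS.
  - exact: measurable_funTS.
  - by move=> w _; exact: nd.
near=> k; rewrite -ge0_integral_full//; apply: le_trans (integral_hitting_time_min k) _.
rewrite lee_fin ler_pM2l// -[leRHS]mul1r ler_pM2r ?invr_gt0// lerBlDr lerDl exprn_ge0//.
exact: no_hit_prob_ge0.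
Unshelve. all: by end_near. Qed.

Variables (K e eps : R).
Hypotheses (K0 : 0 <= K) (eps0 : 0 < eps) (eeps : e <= eps / 2)
  (UI : (\int[P]_(w in [set w | K%:E < `|T n.+1 w / mu%:E|]) `|T n.+1 w / mu%:E|
          <= e%:E)%E).

(** If tau exceeds y, then either k blocks pass without a hit or they last too long. *)
Lemma hitting_tail_upper k y : (0 < k)%N -> (1 + eps) * (k%:R * mu) <= y ->
  (P [set w | y%:E < tau w] <=
    (q n ^+ k + (12 * K ^+ 2 / (k%:R * eps ^+ 2) + 2 * e / eps))%:E)%E.
Proof.
move=> k0 ky.
have mD : measurable [set w | (((1 + eps) * (k%:R * mu))%:E < T (k * n.+1) w)%E].
  by rewrite -[X in measurable X]setTI; exact: emeasurable_fun_o_infty.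
have h1 := blocks_upper_tail Hreg mu0 K0 muE UI eps0 k0.
have h2 : (P (no_hit eta A (k * n.+1)) <= (q n ^+ k)%:E)%E.
  by rewrite (no_hit_probE Hreg mA) lee_fin no_hit_prob_expr_ge.
rewrite EFinD; apply: le_trans (leeD h2 h1).
apply: le_trans (measureU2 _ (mnh _) mD); apply: le_measure; rewrite ?inE//.
- exact: measurable_hitting_tail.
- exact: measurableU.
move=> w /= yt; have [le|lt] := leP (T (k * n.+1) w) (tau w); [by left|right].
by apply: le_lt_trans (lt_trans yt lt); rewrite lee_fin.
Qed.

Lemma hitting_tail_lower k y : (0 < k)%N -> y <= (1 - eps) * (k%:R * mu) ->
  ((q n ^+ k - k%:R * (1 - q 1) - 12 * K ^+ 2 / (k%:R * eps ^+ 2))%:E <=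
    P [set w | y%:E < tau w])%E.
Proof.
move=> k0 ky.
have mD : measurable [set w | (T (k * n.+1) w <= ((1 - eps) * (k%:R * mu))%:E)%E].
  by rewrite -[X in measurable X]setTI; exact: emeasurable_fun_infty_c.
have h1 := blocks_lower_tail Hreg mu0 K0 muE UI eps0 eeps k0.
have mt := measurable_hitting_tail y.
have h2 : ((q (k * n.+1))%:E <= P [set w | y%:E < tau w] +
    (12 * K ^+ 2 / (k%:R * eps ^+ 2))%:E)%E.
  rewrite -(no_hit_probE Hreg mA); apply: le_trans (leeD2l _ h1).
  apply: le_trans (measureU2 _ mt mD); apply: le_measure; rewrite ?inE//.
    exact: measurableU.
  move=> w; rewrite /no_hit /mkset => nh.
  have [le|lt] := leP (T (k * n.+1) w) ((1 - eps) * (k%:R * mu))%:E; [by right|left].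
  by apply: lt_le_trans nh; apply: le_lt_trans lt; rewrite lee_fin.
have := no_hit_prob_expr_le Hreg mA n k.
move: h2; have : P [set w | (y%:E < tau w)%E] \is a fin_num by exact: fin_num_measure.
case: (P [set w | (y%:E < tau w)%E]) => [a| |]// _; rewrite -EFinD !lee_fin.
lra.
Qed.

End hitting_time_estimates.

(** * Passage to the limit *)

Section exponential_limit.
Context {R : realType}.
(** In the application, [r m] is the no-hit probability of a shortened block and [G m x] the
    probability that tau exceeds x mu_m / delta_m; on this scale a block has mean duration
    [delta m]. *)
Variables (delta r : nat -> R) (G : nat -> R -> R).
Hypotheses (delta0 : forall m, 0 < delta m) (delta_cvg : delta @ \oo --> (0 : R)).

Section trunc_sequence.
Variable y : R.
Hypothesis y0 : 0 < y.
Let k m := Num.truncn (y / delta m).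

Lemma truncM_le m : (k m)%:R * delta m <= y.
Proof. by rewrite -ler_pdivlMr// truncn_le// divr_ge0// ltW. Qed.

Lemma truncM_cvg : (k m)%:R * delta m @[m --> \oo] --> y.
Proof.
have h1 m : y - delta m <= (k m)%:R * delta m.
  have := ltW (truncnS_gt (y / delta m)); rewrite -natr1 ler_pdivrMr// mulrDl mul1r.
  by rewrite lerBlDr.
apply: (squeeze_cvgr (f := fun m => y - delta m) (h := cst y)).
- by near=> m; rewrite h1 truncM_le.
- by rewrite -[X in _ --> X]subr0; apply: cvgB => //; exact: cvg_cst.
- exact: cvg_cst.
Unshelve. all: by end_near. Qed.

Lemma trunc_gt0 : \forall m \near \oo, (0 < k m)%N.
Proof.
near=> m; rewrite truncn_gt0 ler_pdivlMr// mul1r ltW//.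
by near: m; apply: (cvgr_lt _ delta_cvg).
Unshelve. all: by end_near. Qed.

Lemma truncV_cvg : (k m)%:R^-1 @[m --> \oo] --> (0 : R).
Proof.
have : delta m * ((k m)%:R * delta m)^-1 @[m --> \oo] --> 0 * y^-1.
  by apply: cvgM => //; apply: cvgV; [rewrite gt_eqF|exact: truncM_cvg].
rewrite mul0r; apply: cvg_trans; apply: near_eq_cvg; near=> m.
have : (0 < k m)%N by near: m; exact: trunc_gt0.
rewrite -(ltr0n R) => k0; rewrite invfM mulrCA mulfV ?mulr1// gt_eqF//.
Unshelve. all: by end_near. Qed.

End trunc_sequence.

Hypothesis r_bounds : \forall m \near \oo,
  1 - delta m < r m <= 1 - delta m + delta m ^+ 2.
Hypothesis G_upper : forall e : R, 0 < e -> exists K : R, \forall m \near \oo,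
  forall (eps : R) k (x : R), 0 < eps -> (0 < k)%N -> (1 + eps) * (k%:R * delta m) <= x ->
  G m x <= r m ^+ k + (K / (k%:R * eps ^+ 2) + 2 * e / eps).
Hypothesis G_lower : forall e : R, 0 < e -> exists K : R, \forall m \near \oo,
  forall (eps : R) k (x : R), 0 < eps -> e <= eps / 2 -> (0 < k)%N ->
  x <= (1 - eps) * (k%:R * delta m) ->
  r m ^+ k - k%:R * delta m ^+ 2 - K / (k%:R * eps ^+ 2) <= G m x.

Lemma tail_le_near (x eta : R) : 0 < x -> 0 < eta ->
  \forall m \near \oo, G m x < expR (- x) + eta.
Proof.
move=> x0 eta0.
have [y [y0 yx ye]] : exists y, [/\ 0 < y, y < x & expR (- y) < expR (- x) + eta / 2].
  have cont : (fun z : R => expR (- z)) @ x --> expR (- x).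
    by apply: continuous_comp; [exact: opp_continuous|exact: continuous_expR].
  have : \forall z \near x^'-, [/\ 0 < z, z < x & expR (- z) < expR (- x) + eta / 2].
    near=> z; split; [by near: z; exact: nbhs_left_gt|by near: z; exact: nbhs_left_lt|].
    near: z; apply: (cvgr_lt (expR (- x))); last by rewrite ltrDl divr_gt0.
    exact: cvg_at_left_filter.
  by move=> /filter_ex[y]; exists y.
pose eps := x / y - 1.
(* This eps satisfies (1 + eps) y = x, and e = eta eps / 8 below turns 2 e / eps into eta / 4. *)
have eps0 : 0 < eps by rewrite subr_gt0 ltr_pdivlMr// mul1r.
have [K hK] := G_upper (e := eta * eps / 8) ltac:(by rewrite !mulr_gt0).
pose k m := Num.truncn (y / delta m).
pose F m := expR (- ((1 - delta m) * ((k m)%:R * delta m))) +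
  (K / eps ^+ 2 * (k m)%:R^-1 + eta / 4).
have cF : F m @[m --> \oo] --> expR (- ((1 - 0) * y)) + (K / eps ^+ 2 * 0 + eta / 4).
  apply: cvgD.
    apply: continuous_cvg; first exact: continuous_expR.
    apply: cvgN; apply: cvgM; last exact: truncM_cvg.
    by apply: cvgB => //; exact: cvg_cst.
  apply: cvgD; last exact: cvg_cst.
  by apply: cvgM; [exact: cvg_cst|exact: truncV_cvg].
have limF : expR (- ((1 - 0) * y)) + (K / eps ^+ 2 * 0 + eta / 4) < expR (- x) + eta.
  rewrite subr0 mul1r mulr0 add0r; have : eta / 4 < eta / 2 by lra.
  by move: ye; lra.
near=> m.
have k0 : (0 < k m)%N by near: m; exact: trunc_gt0.
have kR : 0 < (k m)%:R :> R by rewrite ltr0n.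
have d0 := delta0 m.
have d1 : delta m < 1 by near: m; apply: (cvgr_lt _ delta_cvg).
have /andP[r1 r2] : 1 - delta m < r m <= 1 - delta m + delta m ^+ 2 by near: m.
have /(_ eps (k m) x eps0 k0) h : forall eps' k x', 0 < eps' -> (0 < k)%N ->
    (1 + eps') * (k%:R * delta m) <= x' ->
    G m x' <= r m ^+ k + (K / (k%:R * eps' ^+ 2) + 2 * (eta * eps / 8) / eps').
  by near: m; exact: hK.
apply: (@le_lt_trans _ _ (F m)); last first.
  by near: m; exact: (cvgr_lt _ cF).
apply: le_trans (h _) _.
  rewrite /eps subrKC mulrC mulrA ler_pdivrMr// mulrC ler_pM2l//.
  exact: truncM_le.
rewrite /F lerD//.
  (* The upper bound on [r m] and 1 + z <= e^z give r^k <= e^(-k (delta - delta^2)). *)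
  have -> : - ((1 - delta m) * ((k m)%:R * delta m)) =
      (k m)%:R * - (delta m - delta m ^+ 2) by ring.
  rewrite expRM_natl ler_pXn2r// ?nnegrE ?expR_ge0//; last by lra.
  by apply: le_trans (expR_ge1Dx _); lra.
rewrite lerD//.
  by rewrite invfM mulrA mulrAC.
by rewrite le_eqVlt; apply/orP; left; apply/eqP; field; rewrite gt_eqF.
Unshelve. all: by end_near. Qed.

Lemma tail_ge_near (x eta : R) : 0 < x -> 0 < eta ->
  \forall m \near \oo, expR (- x) - eta < G m x.
Proof.
move=> x0 eta0.
have [y [yx ye]] : exists y, x < y /\ expR (- x) - eta / 2 < expR (- y).
  have cont : (fun z : R => expR (- z)) @ x --> expR (- x).
    by apply: continuous_comp; [exact: opp_continuous|exact: continuous_expR].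
  have : \forall z \near x^'+, x < z /\ expR (- x) - eta / 2 < expR (- z).
    near=> z; split; first by near: z; exact: nbhs_right_gt.
    near: z; apply: (cvgr_gt (expR (- x))); last by rewrite ltrBlDr ltrDl divr_gt0.
    exact: cvg_at_right_filter.
  by move=> /filter_ex[y]; exists y.
have y0 : 0 < y by exact: lt_trans yx.
(* Half of the available margin, so that x < (1 - eps) y strictly: k delta only approaches y from
   below. *)
pose eps := (1 - x / y) / 2.
have eps0 : 0 < eps by rewrite divr_gt0// subr_gt0 ltr_pdivrMr// mul1r.
have xlt : x / (1 - eps) < y.
  have e1 : 1 - eps = (y + x) / (2 * y) by rewrite /eps; field; rewrite gt_eqF.
  rewrite e1 ltr_pdivrMr ?divr_gt0 ?addr_gt0 ?mulr_gt0//.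
  rewrite (_ : y * _ = (y + x) / 2); last by field; rewrite gt_eqF.
  by lra.
have [K hK] := G_lower (e := eps / 2) ltac:(by rewrite divr_gt0).
pose k m := Num.truncn (y / delta m).
pose F m := expR (- ((k m)%:R * delta m / (1 - delta m))) -
  (k m)%:R * delta m * delta m - K / eps ^+ 2 * (k m)%:R^-1.
have ckd := truncM_cvg y0.
have cF : F m @[m --> \oo] --> expR (- (y / (1 - 0))) - y * 0 - K / eps ^+ 2 * 0.
  apply: cvgB; last by apply: cvgM; [exact: cvg_cst|exact: truncV_cvg].
  apply: cvgB; last exact: cvgM.
  apply: continuous_cvg; first exact: continuous_expR.
  apply: cvgN; apply: cvgM => //; apply: cvgV; first by rewrite subr0 oner_eq0.
  by apply: cvgB => //; exact: cvg_cst.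
have limF : expR (- x) - eta < expR (- (y / (1 - 0))) - y * 0 - K / eps ^+ 2 * 0.
  rewrite subr0 divr1 !mulr0 !subr0; have : eta / 2 < eta by lra.
  by move: ye; lra.
near=> m.
have k0 : (0 < k m)%N by near: m; exact: trunc_gt0.
have kR : 0 < (k m)%:R :> R by rewrite ltr0n.
have d0 := delta0 m.
have d1 : delta m < 1 by near: m; apply: (cvgr_lt _ delta_cvg).
have /andP[r1 r2] : 1 - delta m < r m <= 1 - delta m + delta m ^+ 2 by near: m.
have /(_ eps (k m) x eps0 (lexx _) k0) h : forall eps' k x', 0 < eps' ->
    eps / 2 <= eps' / 2 -> (0 < k)%N -> x' <= (1 - eps') * (k%:R * delta m) ->
    r m ^+ k - k%:R * delta m ^+ 2 - K / (k%:R * eps' ^+ 2) <= G m x'.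
  by near: m; exact: hK.
apply: (@lt_le_trans _ _ (F m)).
  by near: m; exact: (cvgr_gt _ cF).
apply: le_trans (h _); last first.
  have e1 : 0 < 1 - eps.
    have : 0 < x / y by exact: divr_gt0.
    by rewrite /eps; lra.
  rewrite mulrC -ler_pdivrMr// ltW//.
  by near: m; exact: (cvgr_gt _ ckd).
rewrite /F lerB//; last by rewrite invfM mulrA mulrAC.
rewrite lerB//; last by rewrite expr2 mulrA.
have d1' : 0 < 1 - delta m by rewrite subr_gt0.
(* Since 1 / (1 - delta) = 1 + delta / (1 - delta), the same convexity inequality yields 1 - delta
   >= e^(-delta / (1 - delta)). *)
have -> : - ((k m)%:R * delta m / (1 - delta m)) = (k m)%:R * - (delta m / (1 - delta m)).
  by rewrite mulrN mulrA.
rewrite expRM_natl ler_pXn2r// ?nnegrE ?expR_ge0//; last by lra.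
apply: le_trans (ltW r1); rewrite expRN -[leRHS]invrK lef_pV2 ?posrE ?expR_gt0 ?invr_gt0//.
apply: le_trans (expR_ge1Dx _); rewrite le_eqVlt; apply/orP; left; apply/eqP.
by field; rewrite gt_eqF.
Unshelve. all: by end_near. Qed.

Lemma tail_cvg (x : R) : 0 < x -> G m x @[m --> \oo] --> expR (- x).
Proof.
move=> x0; apply/cvgrPdist_lt => eta eta0; near=> m.
rewrite ltr_norml; apply/andP; split.
  rewrite ltrBrDl -ltrBrDr opprK; near: m; exact: tail_le_near.
rewrite ltrBlDr -ltrBlDl; near: m; exact: tail_ge_near.
Unshelve. all: by end_near. Qed.

Variable a : nat -> R.
Hypothesis a_upper : \forall m \near \oo, a m <= (1 - delta m)^-1.
Hypothesis a_lower : forall (h : R) I, 0 < h -> \forall m \near \oo,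
  \sum_(i < I) h * G m (i.+1%:R * h) <= a m.

Lemma normalized_mean_cvg : a @ \oo --> (1 : R).
Proof.
have ub eta : 0 < eta -> \forall m \near \oo, a m < 1 + eta.
  move=> eta0.
  have c : (1 - delta m)^-1 @[m --> \oo] --> ((1 - 0)^-1 : R).
    apply: cvgV; first by rewrite subr0 oner_eq0.
    by apply: cvgB => //; exact: cvg_cst.
  near=> m; apply: (@le_lt_trans _ _ ((1 - delta m)^-1)); first by near: m.
  by near: m; apply: (cvgr_lt _ c); rewrite subr0 invr1 ltrDl.
have lb eta : 0 < eta -> \forall m \near \oo, 1 - eta < a m.
  move=> eta0.
  have [h h0 hh] : exists2 h : R, 0 < h & 1 - eta / 3 < expR (- h).
    exists (eta / 4); first by rewrite divr_gt0.
    apply: lt_le_trans (expR_ge1Dx _); lra.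
  have [I hI] : exists I, expR (- (I.+1%:R * h)) < eta / 3.
    have qlt : `|expR (- h)| < 1 by rewrite ger0_norm ?expR_ge0// expR_lt1 oppr_lt0.
    have : \forall I \near \oo, expR (- h) ^+ I < eta / 3.
      by apply: (cvgr_lt _ (cvg_expr qlt)); rewrite divr_gt0.
    move=> [I _ hI]; exists I; have := hI I.+1 (leqnSn I).
    by rewrite -expRM_natl mulrN.
  have c : \sum_(i < I) h * G m (i.+1%:R * h) @[m --> \oo] -->
      \sum_(i < I) h * expR (- (i.+1%:R * h)).
    elim: (I) => [|J IH].
      by under eq_cvg do rewrite big_ord0; rewrite big_ord0; exact: cvg_cst.
    under eq_cvg do rewrite big_ord_recr/=; rewrite big_ord_recr/=.
    apply: cvgD => //; apply: cvgM; first exact: cvg_cst.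
    by apply: tail_cvg; rewrite mulr_gt0// ltr0n.
  have lim : 1 - eta < \sum_(i < I) h * expR (- (i.+1%:R * h)).
    (* A telescoping sum, each term by 1 - e^(-h) <= h; the mesh and the cutoff each lose at most
       eta / 3. *)
    have : expR (- h) - expR (- (I.+1%:R * h)) <= \sum_(i < I) h * expR (- (i.+1%:R * h)).
      elim: (I) => [|J IH]; first by rewrite big_ord0 mul1r subrr.
      rewrite big_ord_recr /=; have : expR (- (J.+1%:R * h)) - expR (- (J.+2%:R * h)) <=
          h * expR (- (J.+1%:R * h)).
        have -> : - (J.+2%:R * h) = - (J.+1%:R * h) - h by rewrite -[J.+2%:R]natr1; ring.
        rewrite expRD; have := expR_ge1Dx (- h); have := expR_gt0 (- (J.+1%:R * h)).
        by nra.
      by move: IH; lra.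
    by move: hh hI; lra.
  near=> m; apply: (@lt_le_trans _ _ (\sum_(i < I) h * G m (i.+1%:R * h))).
    by near: m; exact: (cvgr_gt _ c).
  by near: m; exact: a_lower.
apply/cvgrPdist_lt => eta eta0; near=> m.
rewrite ltr_norml; apply/andP; split.
  rewrite ltrBrDl -ltrBrDr opprK; near: m; exact: ub.
rewrite ltrBlDr -ltrBlDl; near: m; exact: lb.
Unshelve. all: by end_near. Qed.

Hypothesis G_antitone : forall m (x y : R), x <= y -> G m y <= G m x.

(** The evaluation point moves with m, but is eventually caught between fixed x1 < s < x2;
    monotonicity and continuity of the limit conclude. *)
Lemma normalized_tail_cvg (s : R) : 0 < s -> G m (s * a m) @[m --> \oo] --> expR (- s).
Proof.
move=> s0; have ca := normalized_mean_cvg.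
have csa : s * a m @[m --> \oo] --> s.
  by rewrite -[X in _ --> X]mulr1; apply: cvgM => //; exact: cvg_cst.
have cont : (fun z : R => expR (- z)) @ s --> expR (- s).
  by apply: continuous_comp; [exact: opp_continuous|exact: continuous_expR].
apply/cvgrPdist_lt => eta eta0.
have [x1 [x10 x1s x1e]] : exists y, [/\ 0 < y, y < s & expR (- y) < expR (- s) + eta].
  have : \forall z \near s^'-, [/\ 0 < z, z < s & expR (- z) < expR (- s) + eta].
    near=> z; split; [by near: z; exact: nbhs_left_gt|by near: z; exact: nbhs_left_lt|].
    near: z; apply: (cvgr_lt (expR (- s))); last by rewrite ltrDl.
    exact: cvg_at_left_filter.
  by move=> /filter_ex[y]; exists y.
have [x2 [sx2 x2e]] : exists y, s < y /\ expR (- s) - eta < expR (- y).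
  have : \forall z \near s^'+, s < z /\ expR (- s) - eta < expR (- z).
    near=> z; split; first by near: z; exact: nbhs_right_gt.
    near: z; apply: (cvgr_gt (expR (- s))); last by rewrite ltrBlDr ltrDl.
    exact: cvg_at_right_filter.
  by move=> /filter_ex[y]; exists y.
have c1 := tail_cvg x10; have c2 := tail_cvg (lt_trans s0 sx2).
near=> m.
have s1 : x1 <= s * a m by apply: ltW; near: m; exact: (cvgr_gt _ csa).
have s2 : s * a m <= x2 by apply: ltW; near: m; exact: (cvgr_lt _ csa).
have g1 : G m x1 < expR (- s) + eta by near: m; exact: (cvgr_lt _ c1).
have g2 : expR (- s) - eta < G m x2 by near: m; exact: (cvgr_gt _ c2).
have := G_antitone m s1; have := G_antitone m s2 => h1 h2.
by rewrite ltr_norml; apply/andP; split; lra.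
Unshelve. all: by end_near. Qed.

End exponential_limit.

(** * Finiteness of the quantile *)

Section hitting_quantile.
Context {R : realType} {S : polishMetricType R}.
Variables (X : markov_chain S) (eta : trajectory S -> \bar R)
  (nu : probability (borel S) R) (A : set (borel S)).
Hypotheses (Hreg : regeneration X eta nu) (mA : measurable A).
Local Notation P := (chain_prob X nu).
Local Notation q := (no_hit_prob X eta nu A).

Lemma hitting_quantileP (delta : R) :
  (forall k, 1 - q k < delta) /\ hitting_quantile X eta nu A delta = +oo%E \/
  exists n, [/\ hitting_quantile X eta nu A delta = n%:R%:E, delta <= 1 - q n &
    forall k, (k < n)%N -> 1 - q k < delta].
Proof.
have [ex|nex] := pselect (exists k, delta <= 1 - q k); [right|left].
  case: (ex_minnP ex) => n dn nmin; exists n; split=> //; last first.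
    by move=> k kn; rewrite ltNge; apply/negP => /nmin; rewrite leqNgt kn.
  apply/eqP; rewrite eq_le; apply/andP; split.
    by apply: ereal_inf_lbound; exists n => //=; rewrite (hitting_index_prob Hreg mA) lee_fin.
  apply: le_ereal_inf_tmp => _ [k /= + <-].
  by rewrite (hitting_index_prob Hreg mA) !lee_fin ler_nat; exact: nmin.
split.
  by move=> k; rewrite ltNge; apply/negP => dk; apply: nex; exists k.
rewrite /hitting_quantile (_ : [set _ | _ in _] = set0) ?ereal_inf0//.
apply/seteqP; split=> x //= -[k + _].
by rewrite (hitting_index_prob Hreg mA) lee_fin => dk; apply: nex; exists k.
Qed.

(* An infinite quantile is excluded by E[t_k] = k E[eta] and E[eta] > 0. *)
Lemma finite_hitting_quantile (delta : R) : 0 < delta ->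
  (mean P (stopping_sequence_at eta (hitting_quantile X eta nu A delta)) < +oo)%E ->
  exists n, [/\ hitting_quantile X eta nu A delta = n.+1%:R%:E,
    delta <= 1 - q n.+1 & 1 - q n < delta].
Proof.
move=> d0; have [[_ ->]|[n [-> dn nmin]] _] := hitting_quantileP delta; last first.
  (* The quantile is not 0, since [q 0] = 1 and delta > 0; so a block has a last excursion to
     remove. *)
  case: n dn nmin => [|n] dn nmin; last by exists n; split=> //; exact: nmin.
  by move: dn; rewrite no_hit_prob0 ?subrr ?leNgt ?d0//; case: Hreg.
move=> fin; exfalso; have [eta_stop _] := Hreg.
have eta0 := integral_eta_gt0 Hreg.
have T0 k w := stopping_sequence_ge0 eta_stop k w.
have mT k := measurable_stopping_sequence eta_stop k.
have ub k : (k%:R%:E * \int[P]_w eta w <= mean P (stopping_sequence_at eta +oo))%E.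
  rewrite -(integral_stopping_sequence Hreg) /mean.
  apply: ge0_le_integral => //; last by move=> w _; exact: stopping_sequence_at_y.
  rewrite (_ : stopping_sequence_at eta +oo =
      (fun w => esups (fun j => stopping_sequence eta j w) 0)).
    exact: measurable_fun_esups.
  apply/funext => w; rewrite /stopping_sequence_at /esups /sdrop; congr ereal_sup.
  by apply/seteqP; split=> _ [j _ <-]; exists j => //=; rewrite leey.
move: fin ub eta0; case: (\int[P]_w eta w)%E => [r| |]//; last first.
  move=> fin /(_ 1%N); rewrite mul1e leye_eq => /eqP h; by rewrite h ltxx in fin.
case: (mean _ _) => [b| |]//; last by move=> _ /(_ 0%N); rewrite mul0e leeNy_eq.
move=> _ ub; rewrite lte_fin => r0.
have := ub (Num.truncn (b / r)).+1; rewrite -EFinM lee_fin leNgt => /negP; apply.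
by rewrite -ltr_pdivrMr// truncnS_gt.
Qed.

End hitting_quantile.

(** * Choice of the threshold and conclusion *)

Unset Implicit Arguments.
Set Strict Implicit.
Set Printing Implicit Defensive.

Theorem proposition2p1 (R : realType) (S : nat -> polishMetricType R)
    (X : forall m, markov_chain (S m))
    (eta : forall m, trajectory (S m) -> \bar R)
    (nu : forall m, probability (borel (S m)) R)
    (A : forall m, set (borel (S m)))
    (P := fun m => chain_prob (X m) (nu m))
    (tau := fun m => hitting_time (A m))
    (N := fun m => hitting_index (A m) (eta m))
    (n := fun m => hitting_quantile (X m) (eta m) (nu m) (A m))
    (t := fun m => stopping_sequence_at (eta m)) :
  (forall m, regeneration (X m) (eta m) (nu m)) ->
  (forall m, measurable (A m)) ->
  excursion_hit_prob (X m) (eta m) (nu m) (A m) @[m --> \oo] --> (0%E : \bar R) ->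
  if_slowly_enough (fun delta : nat -> R =>
    (exists M : nat,
       (forall m, (M <= m)%N -> (0 < mean (P m) (t m (n m (delta m))) < +oo)%E) /\
       uniformly_integrable [set m | (M <= m)%N] P
         (fun m w => t m (n m (delta m)) w / mean (P m) (t m (n m (delta m))))%E) /\
    (exists C : R, \forall m \near \oo,
       (mean_given (P m) (t m (n m (delta m))) [set w | N m w <= n m (delta m)]
          <= C%:E * mean (P m) (t m (n m (delta m))))%E)) ->
  forall s : R, 0 < s ->
    P m [set w | (s%:E < tau m w / mean (P m) (tau m))%E] @[m --> \oo]
      --> (expR (- s))%:E.
Proof.
move=> Hreg mA p_cvg [delta0 [delta0_gt0 delta0_cvg Hslow]] s s0.
pose q m := no_hit_prob (X m) (eta m) (nu m) (A m).
pose p m := 1 - q m 1.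
have p0 m : 0 <= p m by rewrite subr_ge0 (no_hit_prob_le1 (Hreg m) (mA m)).
have {}p_cvg : p m @[m --> \oo] --> 0.
  have : (p m)%:E @[m --> \oo] --> (0 : R)%:E.
    apply: cvg_trans p_cvg; apply: near_eq_cvg; near=> m.
    by rewrite (excursion_hit_probE (Hreg m)).
  exact: fine_cvg.
pose delta m := Num.max (delta0 m) (Num.sqrt (p m)).
have delta_gt0 m : 0 < delta m by rewrite lt_max delta0_gt0.
have delta_ge m : delta0 m <= delta m by rewrite le_max lexx.
have p_le m : p m <= delta m ^+ 2.
  rewrite -(sqr_sqrtr (p0 m)) ler_pXn2r ?nnegrE ?sqrtr_ge0//; last exact: ltW.
  by rewrite /delta le_max lexx orbT.
have delta_cvg : delta @ \oo --> 0.
  apply: (squeeze_cvgr (f := cst 0) (h := fun m => delta0 m + Num.sqrt (p m))).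
  - by near=> m; rewrite (ltW (delta_gt0 m)) ge_max lerDl sqrtr_ge0 lerDr (ltW (delta0_gt0 m)).
  - exact: cvg_cst.
  - rewrite -[X in _ --> X]addr0; apply: cvgD => //.
    rewrite -[X in _ --> X](@sqrtr0 R); apply: continuous_cvg => //.
    exact: sqrt_continuous.
have [[M [Mpos UI]] _] := Hslow delta delta_cvg delta_ge.
have /choice[blk blkP] : forall m, exists y : nat * R, 0 < y.2 /\ ((M <= m)%N ->
    [/\ n m (delta m) = y.1.+1%:R%:E, delta m <= 1 - q m y.1.+1,
        1 - q m y.1 < delta m &
        (\int[P m]_w stopping_sequence (eta m) y.1.+1 w)%E = y.2%:E]).
  move=> m.
  (* For m < M, the default (0, 1) keeps the mean duration positive for all m. *)
  have [Mm|mM] := leqP M m; last by exists (0%N, 1); split=> //; rewrite leqNgt mM.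
  have /andP[mean0 meany] := Mpos m Mm.
  have [k [nk dk1 dk]] := finite_hitting_quantile (Hreg m) (mA m) (delta_gt0 m) meany.
  move: mean0 meany; rewrite /mean /t /n nk.
  under eq_integral do rewrite (stopping_sequence_at_nat (proj1 (Hreg m))).
  move=> mean0 meany.
  have mfin : (\int[P m]_w stopping_sequence (eta m) k.+1 w)%E \is a fin_num.
    by rewrite ge0_fin_numE// ltW.
  exists (k, fine (\int[P m]_w stopping_sequence (eta m) k.+1 w)%E); split=> /=.
    by apply: fine_gt0; rewrite mean0.
  by move=> _; split=> //; rewrite fineK.
pose b m := (blk m).1; pose mu m := (blk m).2.
have mu0 m : 0 < mu m by case: (blkP m).
have muE m : (M <= m)%N ->
    (\int[P m]_w stopping_sequence (eta m) (b m).+1 w)%E = (mu m)%:E.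
  by move=> Mm; have [_ /(_ Mm)[]] := blkP m.
(* The expected size of E[tau]: about 1 / delta_m blocks of mean duration mu_m. *)
pose c m := mu m / delta m.
have c0 m : 0 < c m by rewrite divr_gt0.
pose r m := q m (b m).
have r_bounds m : (M <= m)%N -> 1 - delta m < r m <= 1 - delta m + delta m ^+ 2.
  move=> Mm; have [_ /(_ Mm)[_ h1 h2 _]] := blkP m.
  have q0 : q m 0 = 1 by apply: no_hit_prob0; case: (Hreg m).
  (* The gap estimate with nothing after the gap: removing the last excursion of a block gains at
     most p_m. *)
  have : q m (b m) * q m 0 <= q m ((b m).+1 + 0)%N + p m.
    exact: (no_hit_prob_mul_le (Hreg m) (mA m)).
  move: h1 h2 (p_le m); rewrite addn0 q0 mulr1 -/(b m) -/(r m) => h1 h2 h3 h4.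
  by apply/andP; split; lra.
have near_M : \forall m \near \oo, (M <= m)%N by exists M.
have delta_lt1 : \forall m \near \oo, delta m < 1 by apply: (cvgr_lt _ delta_cvg).
have UIK e : 0 < e -> exists2 K, 0 <= K & forall m, (M <= m)%N ->
    (\int[P m]_(w in [set w | K%:E < `|stopping_sequence (eta m) (b m).+1 w / (mu m)%:E|])
       `|stopping_sequence (eta m) (b m).+1 w / (mu m)%:E| <= e%:E)%E.
  (* The level must be nonnegative to serve for truncation; raising it only shrinks the domain of
     integration. *)
  move=> e0; have [K hK] := UI e e0; exists (Num.max K 0); first by rewrite le_max lexx orbT.
  move=> m Mm; have := hK m Mm.
  have meanE : mean (P m) (t m (n m (delta m))) = (mu m)%:E.
    have [_ /(_ Mm)[-> _ _ <-]] := blkP m; apply: eq_integral => w _.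
    by rewrite /t (stopping_sequence_at_nat (proj1 (Hreg m))).
  have tE : t m (n m (delta m)) = stopping_sequence (eta m) (b m).+1.
    have [_ /(_ Mm)[-> _ _ _]] := blkP m; apply/funext => w.
    by rewrite /t (stopping_sequence_at_nat (proj1 (Hreg m))).
  rewrite meanE tE; apply: le_trans.
  have mY : measurable_fun setT
      (fun w => `|stopping_sequence (eta m) (b m).+1 w / (mu m)%:E|%E).
    apply: measurableT_comp => //; rewrite inver gt_eqF//; apply: emeasurable_funM => //.
    exact: (measurable_stopping_sequence (proj1 (Hreg m))).
  apply: ge0_subset_integral => //.
  - by rewrite -[X in measurable X]setTI; exact: emeasurable_fun_o_infty.
  - by rewrite -[X in measurable X]setTI; exact: emeasurable_fun_o_infty.
  - exact: measurable_funTS.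
  - by move=> w /=; apply: le_lt_trans; rewrite lee_fin le_max lexx.
pose G m x := fine (P m [set w | ((x * c m)%:E < tau m w)%E]).
have mtail m y : measurable [set w | (y%:E < tau m w)%E].
  exact: measurable_hitting_tail.
have GE m x : P m [set w | ((x * c m)%:E < tau m w)%E] = (G m x)%:E.
  by rewrite fineK// fin_num_measure.
have G_antitone m x y : x <= y -> G m y <= G m x.
  move=> xy; rewrite -lee_fin -!GE le_measure ?inE// => w /=.
  by apply: le_lt_trans; rewrite lee_fin ler_pM2r.
have G_upper (e : R) : 0 < e -> exists K : R, \forall m \near \oo,
  forall (eps : R) k (x : R), 0 < eps -> (0 < k)%N -> (1 + eps) * (k%:R * delta m) <= x ->
  G m x <= r m ^+ k + (K / (k%:R * eps ^+ 2) + 2 * e / eps).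
  move=> e0; have [K K0 hK] := UIK e e0; exists (12 * K ^+ 2); near=> m.
  have Mm : (M <= m)%N by near: m.
  move=> eps k x eps0 k0 kx; rewrite -lee_fin -GE.
  apply: (hitting_tail_upper (Hreg m) (mA m) (mu0 m) (muE m Mm) K0 eps0 (hK m Mm)) => //.
  rewrite (mulrA x) ler_pdivlMr//.
  by rewrite (_ : _ * delta m = (1 + eps) * (k%:R * delta m) * mu m) ?ler_pM2r//; ring.
have G_lower (e : R) : 0 < e -> exists K : R, \forall m \near \oo,
  forall (eps : R) k (x : R), 0 < eps -> e <= eps / 2 -> (0 < k)%N ->
  x <= (1 - eps) * (k%:R * delta m) ->
  r m ^+ k - k%:R * delta m ^+ 2 - K / (k%:R * eps ^+ 2) <= G m x.
  move=> e0; have [K K0 hK] := UIK e e0; exists (12 * K ^+ 2); near=> m.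
  have Mm : (M <= m)%N by near: m.
  move=> eps k x eps0 eeps k0 kx; rewrite -lee_fin -GE.
  have := hitting_tail_lower (Hreg m) (mA m) (mu0 m) (muE m Mm) K0 eps0 eeps (hK m Mm) k0.
  move=> /(_ (x * c m)) h; apply: le_trans (h _).
    by rewrite lee_fin lerD2r lerD2l lerN2 ler_wpM2l// p_le.
  rewrite (mulrA x) ler_pdivrMr//.
  by rewrite (_ : _ * delta m = (1 - eps) * (k%:R * delta m) * mu m) ?ler_pM2r//; ring.
pose a m := fine (\int[P m]_w tau m w) / c m.
have Etau_le : \forall m \near \oo, (\int[P m]_w tau m w <= (c m / (1 - delta m))%:E)%E.
  near=> m; have Mm : (M <= m)%N by near: m.
  have d1 : delta m < 1 by near: m.
  have d0 := delta_gt0 m; have /andP[r1 r2] := r_bounds m Mm.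
  (* Since 1 - [r m] >= delta_m (1 - delta_m), the geometric bound mu / (1 - r) is at most c / (1 -
     delta). *)
  have d2 : 0 < delta m - delta m ^+ 2 by rewrite expr2; nra.
  apply: le_trans (integral_hitting_time_le (Hreg m) (mA m) (mu0 m) (muE m Mm) _) _.
    by rewrite -/(q m) -/(r m); lra.
  rewrite lee_fin /c -mulrA ler_pM2l// -invfM lef_pV2 ?posrE.
  - by rewrite -/(q m) -/(r m) mulrBr mulr1 -expr2; lra.
  - by rewrite -/(q m) -/(r m); lra.
  - by rewrite mulr_gt0// subr_gt0.
have tau_ge0 m w : (0 <= tau m w)%E by exact: hitting_time_ge0.
have Etau_fin : \forall m \near \oo,
    (\int[P m]_w tau m w)%E = (fine (\int[P m]_w tau m w))%:E.
  near=> m; rewrite fineK// ge0_fin_numE; last exact: integral_ge0.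
  by apply: (@le_lt_trans _ _ (c m / (1 - delta m))%:E); [near: m|exact: ltry].
have a_upper : \forall m \near \oo, a m <= (1 - delta m)^-1.
  near=> m; rewrite /a ler_pdivrMr// mulrC -lee_fin.
  have <- : (\int[P m]_w tau m w)%E = (fine (\int[P m]_w tau m w))%:E by near: m.
  by near: m.
have a_lower (h : R) I : 0 < h -> \forall m \near \oo,
    \sum_(i < I) h * G m (i.+1%:R * h) <= a m.
  move=> h0; near=> m; rewrite /a ler_pdivlMr// -lee_fin.
  have <- : (\int[P m]_w tau m w)%E = (fine (\int[P m]_w tau m w))%:E by near: m.
  have hc0 : 0 <= h * c m by rewrite mulr_ge0 ?ltW.
  apply: (le_trans _ (hitting_tail_layers (X m) (nu m) (mA m) I hc0)).
  rewrite mulr_suml -sumEFin; apply: lee_sum => i _.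
  by rewrite mulrA GE -EFinM lee_fin mulrAC.
have dM : \forall m \near \oo, 1 - delta m < r m <= 1 - delta m + delta m ^+ 2.
  by near=> m; apply: r_bounds; near: m.
have a_cvg := normalized_mean_cvg delta_gt0 delta_cvg dM G_upper G_lower a_upper a_lower.
have G_cvg := normalized_tail_cvg delta_gt0 delta_cvg dM G_upper G_lower a_upper a_lower
  G_antitone s0.
have : (G m (s * a m))%:E @[m --> \oo] --> (expR (- s))%:E by apply: cvg_EFin => //; near=> m.
apply: cvg_trans; apply: near_eq_cvg; near=> m.
have am0 : 0 < a m by near: m; apply: (cvgr_gt _ a_cvg).
rewrite -GE; congr (P m _); apply/seteqP.
have E : (\int[P m]_w tau m w)%E = (fine (\int[P m]_w tau m w))%:E by near: m.
have E0 : 0 < fine (\int[P m]_w tau m w).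
  by move: am0; rewrite /a pmulr_lgt0// invr_gt0.
rewrite /mean E /a -mulrA -mulrA mulVf ?gt_eqF// mulr1.
by split=> w /=; rewrite inver gt_eqF// lte_pdivlMr// -EFinM.
Unshelve. all: by end_near. Qed.
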